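(* Let $P$ be a finite-dimensional symplectic manifold with a free, proper, symplectic action of a Lie group $G$ with Lie algebra $\mathfrak g$ and an equivariant momentum map $J\colon P\to\mathfrak g^*$. Let $H$ be a $G$-invariant Hamiltonian on $P$ and let $p_e$ be a relative equilibrium with momentum $\mu_e=J(p_e)$. If $p_e$ is $G$-stable, then $p_e$ is $A_{V,W}(\mu_e)$-stable for every pair of neighbourhoods $V$ of $0$ in $\mathfrak n_{\mu_e}^{\rm o}$ and $W$ of $1$ in $G$.
   Context: Notation: $\mathrm{Ad}^*_g$ is the dual of $\mathrm{Ad}_g$, and $J(gp)=\mathrm{Ad}^*_{g^{-1}}J(p)$. $X_H$ is the Hamiltonian vector field and $\Phi_t$ its $G$-equivariant flow. $p_e$ is a relative equilibrium if $X_H(p_e)=\xi_ep_e$ (infinitesimal action) for some $\xi_e\in\mathfrak g$. It is $G$-stable if for every $G$-invariant neighbourhood $U$ of $p_e$ there is a neighbourhood $V$ of $p_e$ such that $\Phi_t(p)\in U$ for all $p\in V$ and all $t$. For a subset $A\subseteq G$, $p_e$ is $A$-stable if for every open neighbourhood $U\subseteq P$ of $p_e$ there is an open neighbourhood $U'\subseteq P$ of $p_e$ such that $p\in U'$ implies $\Phi_t(p)\in AU$ for all $t\in\mathbb R$, where $AU=\{ap: a\in A,\ p\in U\}$. $\mathfrak g_{\mu_e}$ is the Lie algebra of the coadjoint isotropy group of $\mu_e$, $\mathfrak n_{\mu_e}$ is a chosen complement to $\mathfrak g_{\mu_e}$ in $\mathfrak g$, and $\mathfrak n_{\mu_e}^{\rm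 o}\subseteq\mathfrak g^*$ is its annihilator. For a neighbourhood $V$ of $0$ in $\mathfrak n_{\mu_e}^{\rm o}$ and $\nu\in V$, $Z_{\mu_e,\nu}$ is the connected component containing the identity of $\{g\in G:\mathrm{Ad}^*_g(\mu_e+\nu)\in\mu_e+V\}$, $Z_{\mu_e,V}=\bigcup_{\nu\in V}Z_{\mu_e,\nu}$, and for a neighbourhood $W$ of $1$ in $G$, $$A_{V,W}(\mu_e)=\bigcup_{g\in W}gZ_{\mu_e,V}g^{-1}.$$ *)

(* Defs.v *)
(* Manifolds are C^oo, Hausdorff, second countable and modelled on 'rV[R]_n.
   The tangent space at p is 'rV[R]_n itself: a tangent vector at p is
   represented by its coordinates in the preferred chart [chart p] at p.  All
   derivatives below are taken in preferred charts, so they are the intrinsic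
   tangent maps in these coordinates. *)
From HB Require Import structures.
From mathcomp Require Import all_boot all_order all_algebra.
From mathcomp Require Import boolp classical_sets functions reals topology.
From mathcomp Require Import normedtype derive.

Set Implicit Arguments.
Unset Strict Implicit.
Unset Printing Implicit Defensive.
Import Order.TTheory GRing.Theory Num.Theory numFieldNormedType.Exports.

Local Open Scope classical_set_scope.
Local Open Scope ring_scope.

(* U is meant to be open and V finite-dimensional: asking every
   x |-> 'd f x v to be C^k is then the same as asking x |-> 'd f x to be C^k. *)
Fixpoint Ck_on (R : realType) (V W : normedModType R) (k : nat)
    (U : set V) (f : V -> W) : Prop :=
  if k is k'.+1 then
    (forall x, U x -> differentiable f x) /\
    (forall v, Ck_on k' U (fun x => 'd f x v))
  else forall x, U x -> {for x, continuous f}.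

Definition smooth_on (R : realType) (V W : normedModType R)
    (U : set V) (f : V -> W) : Prop := forall k, Ck_on k U f.

(* The atlas is the family of the preferred charts [chart p], whose domain
   [chart_dom p] contains p; [chart] and [chart_inv] are total functions, but
   their values outside [chart_dom p] and its image are irrelevant. *)
HB.mixin Record isManifold (R : realType) (n : nat) M of Topological M := {
  chart_dom : M -> set M ;
  chart : M -> M -> 'rV[R]_n ;
  chart_inv : M -> 'rV[R]_n -> M ;
  chart_dom_open : forall p, open (chart_dom p) ;
  chart_dom_self : forall p, chart_dom p p ;
  chart_image_open : forall p, open (chart p @` chart_dom p) ;
  chartK : forall p x, chart_dom p x -> chart_inv p (chart p x) = x ;
  chart_continuous :
    forall p x, chart_dom p x -> {for x, continuous (chart p)} ;
  chart_inv_continuous : forall p (y : 'rV[R]_n),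
    (chart p @` chart_dom p) y -> {for y, continuous (chart_inv p)} ;
  chart_transition_smooth : forall p q,
    smooth_on [set y | (chart p @` chart_dom p) y /\
                       chart_dom q (chart_inv p y)]
              (chart q \o chart_inv p) ;
  manifold_hausdorff : hausdorff_space M ;
  manifold_second_countable : @second_countable M
}.

#[short(type="manifoldType")]
HB.structure Definition Manifold (R : realType) (n : nat) :=
  {M of isManifold R n M & Topological M}.

Section ManifoldTheory.
Context {R : realType}.

Definition chart_im {n} {M : manifoldType R n} (p : M) : set 'rV[R]_n :=
  chart p @` chart_dom p.

Definition smooth {m n} {M : manifoldType R m} {N : manifoldType R n}
    (f : M -> N) : Prop :=
  continuous f /\
  forall p q, smooth_on
    [set y | chart_im p y /\ chart_dom q (f (chart_inv p y))]
    (chart q \o f \o chart_inv p).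

(* f is smooth on the product manifold L * M, in the product charts. *)
Definition smooth2 {l m n} {L : manifoldType R l} {M : manifoldType R m}
    {N : manifoldType R n} (f : L -> M -> N) : Prop :=
  continuous (fun z : L * M => f z.1 z.2) /\
  forall p q r, smooth_on
    [set y : 'rV[R]_l * 'rV[R]_m |
       [/\ chart_im p y.1, chart_im q y.2 &
           chart_dom r (f (chart_inv p y.1) (chart_inv q y.2))]]
    (fun y => chart r (f (chart_inv p y.1) (chart_inv q y.2))).

Definition smooth_fun {n} {M : manifoldType R n} {W : normedModType R}
    (f : M -> W) : Prop :=
  forall p, smooth_on (chart_im p) (f \o chart_inv p).

Definition tangent_map {m n} {M : manifoldType R m} {N : manifoldType R n}
    (f : M -> N) (p : M) : {linear 'rV[R]_m -> 'rV[R]_n} :=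
  'd (chart (f p) \o f \o chart_inv p) (chart p p).

Definition differential {n} {M : manifoldType R n} {W : normedModType R}
    (f : M -> W) (p : M) : {linear 'rV[R]_n -> W} :=
  'd (f \o chart_inv p) (chart p p).

(* The curve c has tangent vector v at time t; continuity makes c s stay in
   the domain of the chart for s near t. *)
Definition has_velocity {n} {M : manifoldType R n} (c : R -> M) (t : R)
    (v : 'rV[R]_n) : Prop :=
  {for t, continuous c} /\ is_derive t (1 : R) (chart (c t) \o c) v.

End ManifoldTheory.

HB.mixin Record isLieGroup (R : realType) (n : nat) G
    of Manifold R n G & Group G := {
  mulg_smooth : smooth2 (fun x y : G => (x * y)%g) ;
  invg_smooth : smooth (fun x : G => (x^-1)%g)
}.

#[short(type="lieGroupType")]
HB.structure Definition LieGroup (R : realType) (n : nat) :=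
  {G of isLieGroup R n G & Manifold R n G & Group G}.

(* The Lie algebra g of G is the tangent space 'rV[R]_n at 1, and its dual g^*
   is 'cV[R]_n, a column mu acting on a row xi by xi *m mu. *)
Section LieGroupTheory.
Context {R : realType} {n : nat} {G : lieGroupType R n}.
Implicit Types (g : G) (xi : 'rV[R]_n) (mu : 'cV[R]_n).

Definition pairing (mu : 'cV[R]_n) (xi : 'rV[R]_n) : R := (xi *m mu) 0 0.

(* The value g * 1 * g^-1 of conjugation at 1 is 1, so that Ad g is an
   endomorphism of the tangent space at 1. *)
Definition Ad (g : G) : {linear 'rV[R]_n -> 'rV[R]_n} :=
  tangent_map (fun x : G => (g * x * g^-1)%g) (1%g : G).

Definition coAd (g : G) (mu : 'cV[R]_n) : 'cV[R]_n := lin1_mx (Ad g) *m mu.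

Lemma pairing_coAd g mu xi : pairing (coAd g mu) xi = pairing mu (Ad g xi).
Proof. by rewrite /pairing /coAd mulmxA mul_rV_lin1. Qed.

Definition coAd_isotropy (mu : 'cV[R]_n) : set G := [set g | coAd g mu = mu].

(* The Lie algebra of a closed subgroup K: the xi such that exp (t xi) lies in
   K for all t, t |-> exp (t xi) being the one-parameter subgroup gamma with
   initial velocity xi. *)
Definition Lie_algebra_of (K : set G) : set 'rV[R]_n :=
  [set xi | exists gamma : R -> G,
     [/\ forall s t, gamma (s + t) = (gamma s * gamma t)%g,
         has_velocity gamma 0 xi &
         forall t, K (gamma t)]].

Definition is_complement (N : {vspace 'rV[R]_n}) (k : set 'rV[R]_n) : Prop :=
  (forall xi, xi \in N -> k xi -> xi = 0) /\
  (forall xi, exists a b, [/\ k a, b \in N & xi = a + b]).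

Definition annihilator (N : {vspace 'rV[R]_n}) : set 'cV[R]_n :=
  [set nu | forall xi, xi \in N -> pairing nu xi = 0].

(* V is a (not necessarily open) neighbourhood of 0 in the subspace E. *)
Definition nbhs0_in (E V : set 'cV[R]_n) : Prop :=
  V `<=` E /\ exists2 O : set 'cV[R]_n, nbhs (0 : 'cV[R]_n) O & O `&` E `<=` V.

Definition Z_nu (mu : 'cV[R]_n) (V : set 'cV[R]_n) (nu : 'cV[R]_n) : set G :=
  connected_component
    [set g : G | exists2 nu', V nu' & coAd g (mu + nu) = mu + nu'] (1%g : G).

Definition Z_V (mu : 'cV[R]_n) (V : set 'cV[R]_n) : set G :=
  \bigcup_(nu in V) Z_nu mu V nu.

Definition A_VW (mu : 'cV[R]_n) (V : set 'cV[R]_n) (W : set G) : set G :=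
  \bigcup_(g in W) [set (g * z * g^-1)%g | z in Z_V mu V].

End LieGroupTheory.

Section Symplectic.
Context {R : realType} {d : nat} {P : manifoldType R d}.
Implicit Types (omega : P -> 'rV[R]_d -> 'rV[R]_d -> R) (H : P -> R).

(* The 2-form omega read in the chart at p: at the coordinates y, the vectors
   u and v are carried to the preferred chart at the point chart_inv p y. *)
Definition form_in_chart omega (p : P) (u v y : 'rV[R]_d) : R :=
  let q := chart_inv p y in
  let T := 'd (chart q \o chart_inv p) y in
  omega q (T u) (T v).

Record symplectic_form omega : Prop := {
  symplectic_linear : forall p a u u' v,
    omega p (a *: u + u') v = a * omega p u v + omega p u' v ;
  symplectic_skew : forall p u v, omega p u v = - omega p v u ;
  symplectic_nondegenerate : forall p u,
    (forall v, omega p u v = 0) -> u = 0 ;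
  symplectic_smooth : forall p u v,
    smooth_on (chart_im p) (form_in_chart omega p u v) ;
  (* d omega = 0, evaluated on constant vector fields in a chart *)
  symplectic_closed : forall p u v w y, chart_im p y ->
    'D_u (form_in_chart omega p v w) y +
    'D_v (form_in_chart omega p w u) y +
    'D_w (form_in_chart omega p u v) y = 0
}.

(* X_H is defined by omega (X_H, .) = dH; such a vector exists and is unique
   for a symplectic form, so that the default value 0 plays no role. *)
Definition hamiltonian_field omega H (p : P) : 'rV[R]_d :=
  xget 0 [set u | forall v, omega p u v = differential H p v].

(* c is the trajectory t |-> Phi_t p, defined for all times t, of the flow Phi
   of the smooth vector field X (integral curves are unique). *)
Definition flow_line (X : P -> 'rV[R]_d) (p : P) (c : R -> P) : Prop :=
  c 0 = p /\ forall t, has_velocity c t (X (c t)).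

(* Phi_t p is defined and lies in U for all t; completeness of X is not
   assumed. *)
Definition flow_stays_in (X : P -> 'rV[R]_d) (p : P) (U : set P) : Prop :=
  exists2 c, flow_line X p c & forall t, U (c t).

End Symplectic.

Section Actions.
Context {R : realType} {n d : nat} {G : lieGroupType R n}
        {P : manifoldType R d}.
Variables (omega : P -> 'rV[R]_d -> 'rV[R]_d -> R) (act : G -> P -> P).

Definition smooth_action : Prop :=
  [/\ forall p, act 1%g p = p,
      forall g h p, act (g * h)%g p = act g (act h p) &
      smooth2 act].

Definition free_action : Prop := forall g p, act g p = p -> g = 1%g.

Definition proper_action : Prop := forall K : set (P * P),
  compact K -> compact ((fun z : G * P => (act z.1 z.2, z.2)) @^-1` K).

Definition symplectic_action : Prop := forall g p u v,
  omega (act g p) (tangent_map (act g) p u) (tangent_map (act g) p v) =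
  omega p u v.

(* The infinitesimal action of xi; the chart at act 1 p is the one at p. *)
Definition inf_action (xi : 'rV[R]_n) (p : P) : 'rV[R]_d :=
  tangent_map (act^~ p) (1%g : G) xi.

(* X_<J, xi> = inf_action xi, with the sign convention of hamiltonian_field. *)
Definition momentum_map (J : P -> 'cV[R]_n) : Prop :=
  smooth_fun J /\
  forall xi p v, omega p (inf_action xi p) v = pairing (differential J p v) xi.

Definition equivariant_momentum (J : P -> 'cV[R]_n) : Prop :=
  forall g p, J (act g p) = coAd (g^-1)%g (J p).

Definition invariant_hamiltonian (H : P -> R) : Prop :=
  smooth_fun H /\ forall g p, H (act g p) = H p.

Definition relative_equilibrium (H : P -> R) (p : P) : Prop :=
  exists xi, hamiltonian_field omega H p = inf_action xi p.

Definition invariant_set (U : set P) : Prop :=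
  forall g p, U p -> U (act g p).

Definition G_stable (H : P -> R) (pe : P) : Prop :=
  forall U : set P, nbhs pe U -> invariant_set U ->
  exists2 V : set P, nbhs pe V &
    forall p, V p -> flow_stays_in (hamiltonian_field omega H) p U.

Definition set_act (A : set G) (U : set P) : set P :=
  [set act a p | a in A & p in U].

Definition A_stable (A : set G) (H : P -> R) (pe : P) : Prop :=
  forall U : set P, open_nbhs pe U ->
  exists2 U' : set P, open_nbhs pe U' &
    forall p, U' p ->
      flow_stays_in (hamiltonian_field omega H) p (set_act A U).

End Actions.

(* Main.v *)
(* Write mu = J pe, and let n be the complement N.  Freeness makes the infinitesimal
   action at pe injective, and the Lie algebra of the isotropy group of mu is the radical
   of the skew form (xi, eta) |-> <dJ(xi pe), eta> = omega(eta pe, xi pe).  Hence a map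
   theta from P to the Lie algebra exists near pe, whose zeros p satisfy
   J p - mu \in n^o and whose derivative along the orbit of pe is the identity.
   Solving for theta = 0 near pe together with properness turns the zeros of theta
   into a compact slice S: each point q of the neighbourhood G S of pe has a unique
   tau(q) in G with tau(q) q in S, and tau is continuous. By G-stability a trajectory
   c starting near pe stays in G S; put g = tau(c 0)^-1, u_t = tau(c t) c t and z_t =
   g^-1 tau(c t)^-1, so that c t = (g z_t g^-1) (g u_t). Conservation of J gives
   Ad^*_{z_t} J(u_0) = J(u_t) \in mu + V, and t |-> z_t is a path starting at 1, so
   z_t lies in Z_{mu, nu} with nu = J(u_0) - mu. *)
Require Import Defs.
From HB Require Import structures.
From mathcomp Require Import all_boot all_order all_algebra.
From mathcomp Require Import ring lra zify.
From mathcomp Require Import boolp classical_sets functions reals topology.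
From mathcomp Require Import prodnormedzmodule normedtype derive sequences realfun.

Set Implicit Arguments.
Unset Strict Implicit.
Unset Printing Implicit Defensive.
Import Order.TTheory GRing.Theory Num.Theory numFieldNormedType.Exports.

Local Open Scope classical_set_scope.
Local Open Scope ring_scope.

(** * Strict differentiability *)

Section StrictDifferentiability.
Context {R : realType}.

(** Both points vary near [x]. The remainder is thus Lipschitz with a small constant, which is the
    form of estimate a contraction argument needs. *)
Definition strict_diff (V W : normedModType R) (f : V -> W) (x : V)
    (L : V -> W) : Prop :=
  forall e : R, 0 < e ->
    \forall z \near (x, x), `|f z.2 - f z.1 - L (z.2 - z.1)| <= e * `|z.2 - z.1|.

Lemma near_dist_le (V : normedModType R) (x : V) (e : R) : 0 < e ->
  \forall y \near x, `|y - x| <= e.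
Proof.
move=> e0; apply/nbhs_ballP; exists e => // y.
by rewrite -ball_normE/= distrC => /ltW.
Qed.

Lemma near_lipschitz_continuous (V W : normedModType R) (f : V -> W) (x : V) (k : R) :
  0 < k -> (\forall y \near x, `|f y - f x| <= k * `|y - x|) ->
  {for x, continuous f}.
Proof.
move=> k0 fk; apply/cvgrPdist_le => e e0.
have ek : 0 < e / k by rewrite divr_gt0.
near=> y.
have yk : `|y - x| <= e / k by near: y; exact: near_dist_le.
have fy : `|f y - f x| <= k * `|y - x| by near: y.
by rewrite distrC (le_trans fy)// mulrC -ler_pdivlMr.
Unshelve. all: by end_near. Qed.

Lemma is_derive_comp (V W : normedModType R) (c : R -> V) (f : V -> W) (t : R)
    (v : V) :
  is_derive t (1 : R) c v -> differentiable f (c t) ->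
  is_derive t (1 : R) (f \o c) ('d f (c t) v).
Proof.
move=> [dc <-] df; have dc' : differentiable c t by apply/derivable1_diffP.
apply: DeriveDef; first exact/derivable1_diffP/differentiable_comp.
have dfc : differentiable (f \o c) t by exact: differentiable_comp.
by rewrite -!derive1E !derive1E'// diff_comp.
Qed.

Lemma diff_near (V W : normedModType R) (f g : V -> W) (x v : V) :
  differentiable f x -> differentiable g x -> (\near x, f x = g x) ->
  'd f x v = 'd g x v.
Proof. by move=> df dg fg; rewrite -!deriveE//; exact: near_eq_derive. Qed.

Lemma mx_norm_le m n (A : 'M[R]_(m, n)) (C : R) :
  0 <= C -> (forall i j, `|A i j| <= C) -> `|A| <= C.
Proof.
by move=> C0 AC; rewrite /Num.Def.normr/= mx_normrE; apply/bigmax_leP; split.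
Qed.

Lemma coord_norm_le m n (A : 'M[R]_(m, n)) i j : `|A i j| <= `|A|.
Proof.
by rewrite [leRHS]/Num.Def.normr/= mx_normrE; apply: (le_bigmax _ _ (i, j)).
Qed.

Lemma is_derive_coord m n (c : R -> 'M[R]_(m, n)) (t : R) v i j :
  is_derive t (1 : R) c v -> is_derive t (1 : R) (fun s => c s i j) (v i j).
Proof.
move=> [dc <-]; apply: DeriveDef; first by move/derivable_mxP: dc; apply.
by rewrite derive_mx// mxE.
Qed.

(** The scalar mean value theorem applies to each entry along the segment; this suffices because the
    norm of a matrix is the largest absolute value of its entries. *)
Lemma mean_value_ineq (V : normedModType R) m n (f : V -> 'M[R]_(m, n))
    (L : V -> 'M[R]_(m, n)) (a b : V) (C : R) :
  (forall t, 0 <= t <= 1 -> differentiable f (a + t *: (b - a)) /\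
     `|'d f (a + t *: (b - a)) (b - a) - L (b - a)| <= C) ->
  `|f b - f a - L (b - a)| <= C.
Proof.
move=> fL; have C0 : 0 <= C.
  by have [|_] := fL 0; [rewrite lexx ler01|apply: le_trans].
apply: mx_norm_le => // i j; rewrite !mxE.
pose p (t : R) := a + t *: (b - a).
have dp (t : R) : is_derive t (1 : R) p (b - a).
  have -> : p = cst a + (fun t : R => t *: (b - a)) by [].
  rewrite -[b - a in X in is_derive _ _ _ X]add0r.
  apply: is_deriveD; apply: DeriveDef.
    exact/derivable1_diffP.
  by rewrite deriveE// diff_val scale1r.
have dfp (t : R) : 0 <= t <= 1 -> is_derive t (1 : R) (fun s => f (p s) i j)
    ('d f (p t) (b - a) i j).
  move=> t01; have [df _] := fL _ t01.
  exact: (@is_derive_coord _ _ (f \o p)) (is_derive_comp (dp t) df).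
have [||c c01] := @MVT R (fun s => f (p s) i j)
    (fun t => 'd f (p t) (b - a) i j) 0 1 ltr01.
- by move=> t; rewrite in_itv/= => /andP[t0 t1]; apply: dfp; rewrite !ltW.
- apply: derivable_within_continuous => t; rewrite in_itv/= => t01.
  by have [] := dfp t t01.
have -> : p 1 = b by rewrite /p scale1r addrC subrK.
have -> : p 0 = a by rewrite /p scale0r addr0.
rewrite subr0 mulr1 => ->.
have c01' : 0 <= c <= 1 by move: c01; rewrite in_itv/= => /andP[? ?]; rewrite !ltW.
have [_] := fL _ c01'; apply: le_trans; apply: le_trans (coord_norm_le _ i j).
by rewrite !mxE.
Qed.

(* [a i] are coordinates of norm at most 1 in the basis [e]: this covers matrices
   and products of two spaces of matrices. *)
Definition finite_basis (V : normedModType R) : Prop :=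
  exists (I : finType) (e : I -> V) (a : I -> V -> R), forall v,
    v = \sum_i a i v *: e i /\ forall i, `|a i v| <= `|v|.

Lemma finite_basis_mx m n : finite_basis 'M[R]_(m, n).
Proof.
exists ('I_m * 'I_n)%type, (fun ij => delta_mx ij.1 ij.2),
  (fun ij (A : 'M[R]_(m, n)) => A ij.1 ij.2) => A; split.
  by rewrite {1}[A]matrix_sum_delta pair_big.
by move=> i; exact: coord_norm_le.
Qed.

Lemma finite_basis_prod (V W : normedModType R) :
  finite_basis V -> finite_basis W -> finite_basis (V * W)%type.
Proof.
move=> [I [e [a ea]]] [J [f [b fb]]].
exists (I + J)%type,
  (fun i => match i with inl i => (e i, 0) | inr j => (0, f j) end),
  (fun i (v : V * W) => match i with inl i => a i v.1 | inr j => b j v.2 end).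
move=> [v w]; split; last first.
  by rewrite /Num.Def.normr/= => -[] i; rewrite le_max ?(ea v).2 ?(fb w).2 ?orbT.
have fst_sum (T : finType) (F : T -> V * W) : (\sum_i F i).1 = \sum_i (F i).1.
  by elim/big_rec2 : _ => // i x y _ <-.
have snd_sum (T : finType) (F : T -> V * W) : (\sum_i F i).2 = \sum_i (F i).2.
  by elim/big_rec2 : _ => // i x y _ <-.
rewrite big_sumType/= [LHS]surjective_pairing [RHS]surjective_pairing/=.
rewrite !fst_sum !snd_sum/= -(ea v).1 -(fb w).1.
by rewrite !big1 ?addr0 ?add0r// => i _; exact: scaler0.
Qed.

(** The bound on the coordinates makes [\sum_i |f (e i)|] a bound for the operator [f]. *)
Lemma finite_basis_linear_continuous (V W : normedModType R)
    (f : {linear V -> W}) : finite_basis V -> continuous f.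
Proof.
move=> [I [e [a ea]]].
apply/linear_bounded_continuous/linear_boundedP; near=> M => v.
rewrite {1}(ea v).1 linear_sum.
apply: (@le_trans _ _ ((\sum_i `|f (e i)|) * `|v|)); last first.
  by apply: ler_wpM2r => //; near: M; exact: nbhs_pinfty_ge.
rewrite mulr_suml; apply: le_trans (ler_norm_sum _ _ _) _.
apply: ler_sum => i _; rewrite linearZ normrZ mulrC; apply: ler_wpM2l => //.
exact: (ea v).2.
Unshelve. all: by end_near. Qed.

Lemma norm_pair (V W : normedModType R) (v : V) (w : W) :
  `|(v, w)| = Num.max `|v| `|w|.
Proof. by []. Qed.

(** The mean value inequality is applied on segments near [x]. The finite basis turns continuity of
    ['d f y v] for each fixed [v] into closeness of ['d f y] to ['d f x] uniformly in the
    direction. *)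
Lemma C1_strict_diff (V : normedModType R) m n (f : V -> 'M[R]_(m, n)) (x : V) :
  finite_basis V ->
  (\forall y \near x, differentiable f y) ->
  (forall v, {for x, continuous (fun y => 'd f y v)}) ->
  strict_diff f x ('d f x).
Proof.
move=> [I [e [a ea]]] fd fc eps eps0; pose k := #|I|.
(* The share of [eps] available to each of the [k] basis directions; [k.+1] avoids a zero
   denominator for an empty basis. *)
have eps1 : 0 < eps / k.+1%:R by rewrite divr_gt0.
have : \forall y \near x, differentiable f y /\
    forall i, `|'d f x (e i) - 'd f y (e i)| <= eps / k.+1%:R.
  near=> y; split; first by near: y.
  near: y; apply: filter_forall => i.
  by move/cvgrPdist_le : (fc (e i)) => /(_ _ eps1).
move=> /nbhs_ballP[r r0 xr].
exists (ball x r, ball x r); first by split; exact: nbhsx_ballx.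
move=> [p q] [/= xp xq]; apply: mean_value_ineq => t t01.
have : ball x r (p + t *: (q - p)).
  move: xp xq; rewrite -!ball_normE/= => xp xq.
  have -> : x - (p + t *: (q - p)) = (1 - t) *: (x - p) + t *: (x - q).
    have -> : q - p = (x - p) - (x - q) by rewrite opprB [RHS]addrC subrKA.
    by rewrite scalerBl scale1r scalerBr opprD opprB addrA addrA addrAC.
  case/andP: t01 => t0 t1.
  apply: le_lt_trans (ler_normD _ _) _; rewrite !normrZ ger0_norm ?subr_ge0//.
  rewrite (ger0_norm t0).
  have M0 : Num.max `|x - p| `|x - q| < r by rewrite gt_max xp.
  apply: le_lt_trans M0; set M := Num.max _ _.
  have -> : M = (1 - t) * M + t * M by ring.
  by apply: lerD; apply: ler_wpM2l; rewrite ?subr_ge0// le_max lexx ?orbT.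
move=> /xr[df dfe]; split=> //.
set y := p + _; set v := q - p.
have dE (z : V) : 'd f z v = \sum_i a i v *: 'd f z (e i).
  by rewrite {1}(ea v).1 linear_sum; apply: eq_bigr => i _; rewrite linearZ.
rewrite !dE -sumrB; apply: le_trans (ler_norm_sum _ _ _) _.
apply: (@le_trans _ _ (\sum_(i : I) (eps / k.+1%:R * `|v|))).
  apply: ler_sum => i _; rewrite -scalerBr normrZ mulrC.
  by apply: ler_pM => //; [rewrite distrC|rewrite (ea v).2].
rewrite sumr_const -(mulr_natr (_ * _) k) mulrAC; apply: ler_wpM2r => //.
rewrite -mulrA -[leRHS]mulr1; apply: ler_wpM2l; first exact: ltW.
by rewrite mulrC ler_pdivrMr// mul1r ler_nat.
Unshelve. all: by end_near. Qed.

Lemma strict_diff_comp (U V W : normedModType R) (f : U -> V) (g : V -> W)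
    (x : U) (K : U -> V) (L : {linear V -> W}) :
  {for x, continuous f} -> continuous L ->
  (exists2 k, 0 < k & forall u, `|K u| <= k * `|u|) ->
  strict_diff f x K -> strict_diff g (f x) L -> strict_diff (g \o f) x (L \o K).
Proof.
move=> fc Lc [k k0 Kk] sf sg e e0.
have [l l0 Ll] := linear_lipschitz Lc.
have e1 : 0 < e / 2 / (k + 1) by rewrite !divr_gt0// addr_gt0.
(* The bound [1] keeps the increment of [f] below [(k + 1) * |v|]; the bound [e / 2 / l] makes [L]
   of the error of [f] at most [e / 2 * |v|]. *)
have e2 : 0 < Num.min 1 (e / 2 / l) by rewrite lt_min ltr01 !divr_gt0.
have fcc : (f z.1, f z.2) @[z --> (x, x)] --> (f x, f x).
  apply: cvg_pair; apply: continuous_comp => //=.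
  - exact: cvg_fst.
  - exact: cvg_snd.
near=> z.
have h1 : `|f z.2 - f z.1 - K (z.2 - z.1)| <= Num.min 1 (e / 2 / l) * `|z.2 - z.1|.
  by near: z; exact: sf.
have h2 : `|g (f z.2) - g (f z.1) - L (f z.2 - f z.1)| <=
    e / 2 / (k + 1) * `|f z.2 - f z.1|.
  near: z; apply: (fcc [set w |
    `|g w.2 - g w.1 - L (w.2 - w.1)| <= e / 2 / (k + 1) * `|w.2 - w.1|]).
  exact: sg.
rewrite /=; set v := z.2 - z.1 in h1 *; set w := f z.2 - f z.1 in h1 h2.
have -> : g (f z.2) - g (f z.1) - L (K v) =
    (g (f z.2) - g (f z.1) - L w) + L (w - K v).
  by rewrite (linearB L w (K v)) addrA subrK.
apply: le_trans (ler_normD _ _) _.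
have hw : `|w| <= (k + 1) * `|v|.
  rewrite -[w](subrK (K v)) addrC mulrDl; apply: le_trans (ler_normD _ _) _.
  apply: lerD (Kk _) _; apply: le_trans h1 _; apply: ler_wpM2r => //.
  by rewrite ge_min lexx.
have -> : e * `|v| = e / 2 / (k + 1) * ((k + 1) * `|v|) + l * (e / 2 / l * `|v|).
  by field; rewrite !gt_eqF// addr_gt0.
apply: lerD.
  by apply: le_trans h2 _; apply: ler_wpM2l => //; exact: ltW.
apply: le_trans (Ll _) _; apply: ler_wpM2l; first exact: ltW.
apply: le_trans h1 _; apply: ler_wpM2r => //.
by rewrite ge_min lexx orbT.
Unshelve. all: by end_near. Qed.

End StrictDifferentiability.

(** * Charts and smooth maps *)

Lemma compact_norm_ball {R : realType} {n : nat} (x : 'rV[R]_n) (r : R) : 0 < r ->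
  compact [set y | `|y - x| <= r].
Proof.
move=> r0; have -> : [set y | `|y - x| <= r] = closed_ball x r.
  by rewrite closed_ballE//; apply/seteqP; split=> y /=; rewrite /closed_ball_/= distrC.
apply: bounded_closed_compact; last exact: closed_ball_closed.
exists (`|x| + r); split; first exact: num_real.
move=> u ur y; rewrite closed_ballE// /closed_ball_/= => yr; apply/ltW/(le_lt_trans _ ur).
rewrite -[y](subrK x) addrC; apply: le_trans (ler_normD _ _) _.
by rewrite lerD// distrC.
Qed.

Section Charts.
Context {R : realType} {n : nat} {M : manifoldType R n}.
Implicit Types p q x : M.

Lemma chart_dom_nbhs p x : chart_dom p x -> nbhs x (chart_dom p).
Proof. by move=> px; apply: open_nbhs_nbhs; split=> //; exact: chart_dom_open. Qed.

Lemma chart_im_nbhs p y : chart_im p y -> nbhs y (chart_im p).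
Proof. by move=> py; apply: open_nbhs_nbhs; split=> //; exact: chart_image_open. Qed.

Lemma chart_im_chart p x : chart_dom p x -> chart_im p (chart p x).
Proof. by move=> px; exists x. Qed.

Lemma chart_im_self p : chart_im p (chart p p).
Proof. exact/chart_im_chart/chart_dom_self. Qed.

Lemma chart_inv_dom p y : chart_im p y -> chart_dom p (chart_inv p y).
Proof. by move=> [x px <-]; rewrite chartK. Qed.

Lemma chart_invK p y : chart_im p y -> chart p (chart_inv p y) = y.
Proof. by move=> [x px <-]; rewrite chartK. Qed.

Lemma chart_self_continuous p : chart p x @[x --> p] --> chart p p.
Proof. exact/chart_continuous/chart_dom_self. Qed.

Lemma chartK_self p : chart_inv p (chart p p) = p.
Proof. by rewrite chartK//; exact: chart_dom_self. Qed.

Lemma chart_inv_self_continuous p : chart_inv p y @[y --> chart p p] --> p.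
Proof. by rewrite -[X in _ --> X]chartK_self; exact/chart_inv_continuous/chart_im_self. Qed.

Lemma compact_chart_ball p (U : set M) : nbhs p U ->
  exists r : R, [/\ 0 < r, (forall y, `|y - chart p p| <= r -> chart_im p y /\ U (chart_inv p y)),
     compact [set y | `|y - chart p p| <= r] &
     compact (chart_inv p @` [set y | `|y - chart p p| <= r])].
Proof.
move=> pU; have : nbhs (chart p p) [set y | chart_im p y /\ U (chart_inv p y)].
  by apply: filterI; [exact/chart_im_nbhs/chart_im_self|exact: chart_inv_self_continuous].
move=> /nbhs_ballP[r r0 rU]; exists (r / 2).
have r2 : 0 < r / 2 by rewrite divr_gt0.
have sub y : `|y - chart p p| <= r / 2 -> chart_im p y /\ U (chart_inv p y).
  move=> yr; apply: rU; rewrite -ball_normE/= distrC (le_lt_trans yr)//.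
  by rewrite ltr_pdivrMr// ltr_pMr// ltr1n.
have K := @compact_norm_ball _ _ (chart p p) _ r2.
split=> //; apply: continuous_compact => //; apply: continuous_in_subspaceT => y.
by rewrite inE/= => /sub[yp _]; exact: chart_inv_continuous.
Qed.

Lemma compact_nbhs p (U : set M) : nbhs p U ->
  exists K : set M, [/\ compact K, nbhs p K & K `<=` U].
Proof.
move=> /compact_chart_ball[r [r0 rU _ Kc]]; eexists; split; first exact: Kc.
- near=> q; exists (chart p q); last first.
    by rewrite chartK//; near: q; exact/chart_dom_nbhs/chart_dom_self.
  rewrite /= distrC; near: q.
  by move/cvgrPdist_le : (@chart_self_continuous p); apply.
- by move=> _ [y /rU[_ ?] <-].
Unshelve. all: by end_near. Qed.

End Charts.

Section DifferentiableMaps.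
Context {R : realType}.

(** Continuity is a separate condition because the values of a chart outside its domain carry no
    information about [f]. *)
Definition diff_at {m n} {M : manifoldType R m} {N : manifoldType R n}
    (f : M -> N) (p : M) : Prop :=
  {for p, continuous f} /\
  differentiable (chart (f p) \o f \o chart_inv p) (chart p p).

Lemma smooth_on_strict_diff (V : normedModType R) m n (U : set V)
    (f : V -> 'M[R]_(m, n)) (x : V) :
  finite_basis V -> smooth_on U f -> nbhs x U ->
  (\forall y \near x, differentiable f y) /\ strict_diff f x ('d f x).
Proof.
move=> Vb /(_ 1)[/= fd fc] xU.
have fd' : \forall y \near x, differentiable f y by apply: filterS xU.
split=> //; apply: C1_strict_diff => // v; apply: fc; exact: nbhs_singleton xU.
Qed.

(** * Velocities of curves in manifolds *)

Section Curves.
Context {m : nat} {M : manifoldType R m}.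
Implicit Types (c : R -> M) (t : R) (p : M).

Lemma is_derive_chart (W : normedModType R) (h : M -> W) c t v :
  has_velocity c t v ->
  differentiable (h \o chart_inv (c t)) (chart (c t) (c t)) ->
  is_derive t (1 : R) (h \o c) ('d (h \o chart_inv (c t)) (chart (c t) (c t)) v).
Proof.
move=> [cc cv] hd; apply: near_eq_is_derive (is_derive_comp cv hd).
near=> s; rewrite /= chartK//; near: s.
by apply: cc; exact/chart_dom_nbhs/chart_dom_self.
Unshelve. all: by end_near. Qed.

Lemma is_derive_smooth_fun (W : normedModType R) (h : M -> W) c t v :
  smooth_fun h -> has_velocity c t v ->
  is_derive t (1 : R) (h \o c) (differential h (c t) v).
Proof.
move=> /(_ (c t) 1)[/= hd _] cv; apply: is_derive_chart => //.
exact/hd/chart_im_self.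
Qed.

Lemma smooth_fun_continuous (W : normedModType R) (h : M -> W) :
  smooth_fun h -> continuous h.
Proof.
move=> hs p; have [/= hd _] := hs p 1%N.
have /differentiable_continuous hc := hd _ (chart_im_self p).
have : ((h \o chart_inv p) \o chart p) x @[x --> p] --> h p.
  rewrite -[X in h X](chartK_self p).
  apply: (@continuous_comp _ _ _ (chart p) (h \o chart_inv p)) => //.
  exact/chart_continuous/chart_dom_self.
apply: cvg_trans; apply: near_eq_cvg; near=> x => /=.
rewrite chartK//; near: x; exact/chart_dom_nbhs/chart_dom_self.
Unshelve. all: by end_near. Qed.

Lemma is_derive_other_chart c t v p : has_velocity c t v -> chart_dom p (c t) ->
  is_derive t (1 : R) (chart p \o c)
    ('d (chart p \o chart_inv (c t)) (chart (c t) (c t)) v).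
Proof.
move=> cv pc; apply: is_derive_chart => //.
have [/= td _] := chart_transition_smooth (c t) p 1.
apply: td; split; first exact: chart_im_self.
by rewrite chartK_self.
Qed.

Lemma has_velocity_comp {n} {N : manifoldType R n} (f : M -> N) c t v :
  has_velocity c t v -> diff_at f (c t) ->
  has_velocity (f \o c) t (tangent_map f (c t) v).
Proof.
move=> cv [fc fd]; split; first by have [cc _] := cv; exact: continuous_comp.
exact: (is_derive_chart (h := chart (f (c t)) \o f)).
Qed.

(** The chain rule for a composite that is constant. With [h] an invariant Hamiltonian and [f] an
    orbit map, it says that [dH] vanishes in the orbit directions. *)
Lemma differential_cst_comp {n} {N : manifoldType R n} (W : normedModType R)
    (h : N -> W) (f : M -> N) p v (w : W) :
  diff_at f p -> smooth_fun h -> (forall x, h (f x) = w) ->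
  differential h (f p) (tangent_map f p v) = 0.
Proof.
move=> [fc fd] /(_ (f p) 1)[/= hd _] hf.
set F := chart (f p) \o f \o chart_inv p in fd.
have Fp : chart (f p) (f p) = F (chart p p) by rewrite /F/= chartK_self.
have {}hd := hd _ (chart_im_self (f p)); rewrite Fp in hd.
have -> : differential h (f p) (tangent_map f p v) =
    'd ((h \o chart_inv (f p)) \o F) (chart p p) v.
  by rewrite (diff_comp fd hd) /differential Fp.
have fc' : f (chart_inv p z) @[z --> chart p p] --> f p.
  exact: cvg_comp (@chart_inv_self_continuous _ _ _ p) fc.
rewrite (@diff_near _ _ _ _ (cst w)) ?diff_cst//.
  exact: differentiable_comp.
near=> y; rewrite /= chartK ?hf//.
near: y; apply: fc'; exact/chart_dom_nbhs/chart_dom_self.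
Unshelve. all: by end_near. Qed.

(** Read in the single chart at [c t0], the velocity is still zero, so the mean value inequality
    with bound 0 freezes the coordinates. *)
Lemma locally_constant_curve c (t0 : R) :
  (\forall t \near t0, has_velocity c t 0) -> \forall t \near t0, c t = c t0.
Proof.
move=> c0; pose p := c t0.
have [cc _] := nbhs_singleton c0.
have : \forall t \near t0, has_velocity c t 0 /\ chart_dom p (c t).
  by apply: filterI => //; apply: cc; exact/chart_dom_nbhs/chart_dom_self.
move=> /nbhs_ballP[r r0 rc]; apply/nbhs_ballP; exists r => //= t.
rewrite -ball_normE/= => tr.
have rc' s : 0 <= s <= 1 -> has_velocity c (t0 + s *: (t - t0)) 0 /\
    chart_dom p (c (t0 + s *: (t - t0))).
  move=> /andP[s0 s1]; apply: rc; rewrite -ball_normE/= opprD addNKr normrN.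
  rewrite normrZ ger0_norm// distrC; apply: le_lt_trans tr.
  by rewrite ler_piMl.
have : `|(chart p \o c) t - (chart p \o c) t0 - cst 0 (t - t0)| <= 0.
  apply: mean_value_ineq => s /rc'[cv pc].
  have [dc dv] := is_derive_other_chart cv pc.
  have dc' : differentiable (chart p \o c) (t0 + s *: (t - t0)).
    exact/derivable1_diffP.
  split=> //; rewrite diff1E// derive1E dv linear0 scaler0 subr0 normr0 //.
rewrite subr0 normr_le0 subr_eq0 => /eqP /= /(congr1 (chart_inv p)).
rewrite !chartK//; first exact: chart_dom_self.
have [] := rc' 1; first by rewrite ler01 lexx.
by rewrite scale1r addrC subrK.
Qed.

End Curves.

(** * Partial tangent maps of smooth maps of two variables *)

Section TwoVariables.
Context {l m n : nat} {L : manifoldType R l} {M : manifoldType R m}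
  {N : manifoldType R n}.
Variable (f : L -> M -> N) (fs : smooth2 f).

Definition in_charts p q (y : 'rV[R]_l * 'rV[R]_m) : 'rV[R]_n :=
  chart (f p q) (f (chart_inv p y.1) (chart_inv q y.2)).

Lemma smooth2_chart_nbhs p q (r : N) : chart_dom r (f p q) ->
  nbhs (chart p p, chart q q) [set y : 'rV[R]_l * 'rV[R]_m |
       [/\ chart_im p y.1, chart_im q y.2 &
           chart_dom r (f (chart_inv p y.1) (chart_inv q y.2))]].
Proof.
move=> rd; have [fc _] := fs.
near=> y; split.
- near: y; apply: (@cvg_fst _ _ (nbhs (chart p p)) (nbhs (chart q q))).
  exact/chart_im_nbhs/chart_im_self.
- near: y; apply: (@cvg_snd _ _ (nbhs (chart p p)) (nbhs (chart q q))).
  exact/chart_im_nbhs/chart_im_self.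
- near: y.
  have h : (chart_inv p y.1, chart_inv q y.2) @[y --> (chart p p, chart q q)] --> (p, q).
    apply: cvg_pair => /=.
      by apply: cvg_comp (@chart_inv_self_continuous _ _ _ p); exact: cvg_fst.
    by apply: cvg_comp (@chart_inv_self_continuous _ _ _ q); exact: cvg_snd.
  have := cvg_comp _ _ h (fc (p, q)); apply.
  exact: chart_dom_nbhs.
Unshelve. all: by end_near. Qed.

Lemma smooth2_strict_diff p q :
  (\forall y \near (chart p p, chart q q), differentiable (in_charts p q) y) /\
  strict_diff (in_charts p q) (chart p p, chart q q)
    ('d (in_charts p q) (chart p p, chart q q)).
Proof.
have [_ fd] := fs; apply: smooth_on_strict_diff (fd p q (f p q)) _.
  by apply: finite_basis_prod; exact: finite_basis_mx.
exact/smooth2_chart_nbhs/chart_dom_self.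
Qed.

Lemma smooth2_diff_at_l p q : diff_at (f^~ q) p /\
  forall v, tangent_map (f^~ q) p v =
    'd (in_charts p q) (chart p p, chart q q) (v, 0).
Proof.
have [/nbhs_singleton fd _] := smooth2_strict_diff p q.
have [fc _] := fs.
pose i (y : 'rV[R]_l) : 'rV[R]_l * 'rV[R]_m := (y, chart q q).
have di : differentiable i (chart p p).
  by apply: differentiable_pair => //; exact: differentiable_cst.
have fi : chart (f p q) \o f^~ q \o chart_inv p = in_charts p q \o i.
  by apply/funext => y; rewrite /in_charts/= chartK_self.
split.
  split.
    apply: (@continuous_comp _ _ _ (fun x => (x, q)) (fun z => f z.1 z.2)); last exact: fc.
    by apply: cvg_pair => //; exact: cvg_cst.
  by rewrite fi; apply: differentiable_comp.
move=> v; rewrite /tangent_map fi diff_comp//= diff_pair//=.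
by rewrite !diff_val.
Qed.

Lemma smooth2_diff_at_r p q : diff_at (f p) q /\
  forall v, tangent_map (f p) q v =
    'd (in_charts p q) (chart p p, chart q q) (0, v).
Proof.
have [/nbhs_singleton fd _] := smooth2_strict_diff p q.
have [fc _] := fs.
pose i (y : 'rV[R]_m) : 'rV[R]_l * 'rV[R]_m := (chart p p, y).
have di : differentiable i (chart q q).
  by apply: differentiable_pair => //; exact: differentiable_cst.
have fi : chart (f p q) \o f p \o chart_inv q = in_charts p q \o i.
  by apply/funext => y; rewrite /in_charts/= chartK_self.
split.
  split.
    apply: (@continuous_comp _ _ _ (fun x => (p, x)) (fun z => f z.1 z.2)); last exact: fc.
    by apply: cvg_pair => //; exact: cvg_cst.
  by rewrite fi; apply: differentiable_comp.
move=> v; rewrite /tangent_map fi diff_comp//= diff_pair//=.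
by rewrite !diff_val.
Qed.

End TwoVariables.

End DifferentiableMaps.

(** * One-parameter subgroups *)

(** A cluster point of an ultrafilter is a limit of it: one of [O] and its complement has a preimage
    in [F], and the complement would miss the neighbourhood [O]. *)
Lemma ultra_cvg_compact (I : Type) (F : set_system I) (T : topologicalType)
    (u : I -> T) (K : set T) :
  UltraFilter F -> compact K -> (\forall i \near F, K (u i)) ->
  exists2 p, K p & u @ F --> p.
Proof.
move=> FU Kc FK; have [p [Kp pF]] := Kc (u @ F) _ FK.
exists p => // O pO; case: (in_ultra_setVsetC (u @^-1` O) FU) => // FO.
by have [q [nOq Oq]] := pF _ _ (FO : (u @ F) (~` O)) pO.
Qed.

(** * Products and powers in coordinates centred at the identity *)

Section LieGroup.
Context {R : realType} {n : nat} {G : lieGroupType R n}.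
Implicit Types g h y : G.

Lemma mulg_cvg (I : Type) (F : set_system I) (u v : I -> G) g h : Filter F ->
  u @ F --> g -> v @ F --> h -> (fun i => u i * v i)%g @ F --> (g * h)%g.
Proof.
move=> FF ug vh; have [mc _] := @mulg_smooth R n G.
exact: cvg_comp (cvg_pair ug vh) (mc (g, h)).
Qed.

Lemma invg_cvg (I : Type) (F : set_system I) (u : I -> G) g : Filter F ->
  u @ F --> g -> (fun i => (u i)^-1)%g @ F --> (g^-1)%g.
Proof.
by move=> FF ug; have [ic _] := @invg_smooth R n G; exact: cvg_comp ug (ic g).
Qed.

(* Chart coordinates centred at 1, meaningful only on [chart_dom 1]. *)
Definition log1 g : 'rV[R]_n := chart (1%g : G) g - chart (1%g : G) 1%g.

Definition log_ball (r : R) : set G :=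
  [set g | chart_dom (1%g : G) g /\ `|log1 g| <= r].

Lemma log1_1 : log1 1%g = 0. Proof. exact: subrr. Qed.

Lemma log_ball_nbhs r : 0 < r -> nbhs (1%g : G) (log_ball r).
Proof.
move=> r0; apply: filterI; first exact/chart_dom_nbhs/chart_dom_self.
have /cvgrPdist_le := @chart_self_continuous _ _ _ (1%g : G).
by move=> /(_ _ r0); apply: filterS => g; rewrite /= distrC.
Qed.

Lemma log_ball_sub (U : set G) : nbhs (1%g : G) U ->
  exists2 r : R, 0 < r & log_ball r `<=` U.
Proof.
move=> /compact_chart_ball[r [r0 rU _ _]]; exists r => // g [g1 gr].
by have [_] := rU _ gr; rewrite chartK.
Qed.

Lemma log_ball_compact : exists2 r : R, 0 < r &
  exists2 K : set G, compact K & log_ball r `<=` K /\ K `<=` chart_dom (1%g : G).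
Proof.
have [r [r0 rU _ K]] := compact_chart_ball (chart_dom_nbhs (chart_dom_self (1%g : G))).
exists r => //; eexists; first exact: K.
split=> [g [g1 gr]|_ [y /rU[_ ?] <-]//].
by exists (chart (1%g : G) g) => //; rewrite chartK.
Qed.

Lemma log_ballW r s : r <= s -> log_ball r `<=` log_ball s.
Proof. by move=> rs g [? ?]; split=> //; apply: le_trans rs. Qed.

Lemma tangent_map_idg (v : 'rV[R]_n) :
  tangent_map (fun x : G => (1 * x)%g) (1%g : G) v = v.
Proof.
have -> : (fun x : G => (1 * x)%g) = id by apply/funext => x; rewrite mul1g.
rewrite /tangent_map (@diff_near _ _ _ _ id) ?diff_val//.
  have [/= td _] := @chart_transition_smooth _ _ _ (1%g : G) 1%g 1.
  apply: td; split; first exact: chart_im_self.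
  by rewrite chartK_self; exact: chart_dom_self.
near=> y; apply: chart_invK; near: y.
exact/chart_im_nbhs/chart_im_self.
Unshelve. all: by end_near. Qed.

(** Strict differentiability of the product at [(1, 1)] compares [(g, 1)] with [(g, h)], and the
    partial derivative in the second factor is the identity. The error is thus proportional to
    [|log1 h|] alone, so that errors of repeated products can be summed. *)
Lemma log1_mul (e : R) : 0 < e -> exists2 r, 0 < r & forall g h,
  log_ball r g -> log_ball r h -> chart_dom (1%g : G) (g * h)%g /\
  `|log1 (g * h)%g - log1 g - log1 h| <= e * `|log1 h|.
Proof.
move=> e0; pose o : G := 1%g; pose m := fun x y : G => (x * y)%g.
have [ms _] := (mulg_smooth : smooth2 m).
have [_ /(_ _ e0)] := smooth2_strict_diff (mulg_smooth : smooth2 m) o o.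
have [_] := smooth2_diff_at_r (mulg_smooth : smooth2 m) o o.
move: ('d (in_charts m o o) _) => D mr md.
have mr' v : D (0, v) = v.
  by rewrite -(mr v); exact: tangent_map_idg.
have cc : chart o x @[x --> o] --> chart o o by exact: chart_self_continuous.
have mgo g : m g o = g by rewrite /m mulg1.
have moo : m o o = o := mgo o.
have oo1 : (chart o z.1, chart o o) @[z --> (o, o)] --> (chart o o, chart o o).
  apply: (@cvg_pair _ _ _ _ (nbhs (chart o o)) (nbhs (chart o o))) => /=; last exact: cvg_cst.
  by apply: cvg_comp cc; exact: cvg_fst.
have oo2 : (chart o z.1, chart o z.2) @[z --> (o, o)] --> (chart o o, chart o o).
  apply: (@cvg_pair _ _ _ _ (nbhs (chart o o)) (nbhs (chart o o))) => /=.
    by apply: cvg_comp cc; exact: cvg_fst.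
  by apply: cvg_comp cc; exact: cvg_snd.
have oo := cvg_pair (G := nbhs (chart o o, chart o o)) (H := nbhs (chart o o, chart o o)) oo1 oo2.
have : \forall z \near (o, o), (chart_dom o z.1 -> chart_dom o z.2 ->
    `|log1 (z.1 * z.2)%g - log1 z.1 - log1 z.2| <= e * `|log1 z.2|) /\
    chart_dom o (z.1 * z.2)%g.
  apply: filterI; last first.
    apply: (ms (o, o)); rewrite /m /= mulg1.
    exact/chart_dom_nbhs/chart_dom_self.
  have := oo (nbhs_filter _) (nbhs_filter _) (nbhs_filter _) _ md.
  apply: (@filterS _ _ (nbhs_filter _)) => -[g h]/= + go ho.
  rewrite /in_charts/= !chartK_self !(chartK _ _ go) !(chartK _ _ ho) moo mgo.
  have -> : (chart o g, chart o h) - (chart o g, chart o o) = (0, log1 h).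
    by rewrite -[LHS]/(chart o g - chart o g, chart o h - chart o o) subrr.
  have -> : `|(0 : 'rV[R]_n, log1 h)| = `|log1 h|.
    by rewrite norm_pair normr0; apply/max_idPr.
  rewrite mr'.
  have -> : log1 (g * h)%g - log1 g = chart o (m g h) - chart o g.
    by rewrite /log1 opprB addrA subrK.
  exact.
move=> [[A B] [/= oA oB] AB].
have [r r0 rA] := log_ball_sub oA; have [s s0 sB] := log_ball_sub oB.
exists (Num.min r s); first by rewrite lt_min r0.
move=> g h gr hr.
have [|H ?] := AB (g, h).
  split=> /=; [apply: rA|apply: sB].
    by apply: log_ballW gr; rewrite ge_min lexx.
  by apply: log_ballW hr; rewrite ge_min lexx orbT.
by split=> //; apply: H; [case: gr|case: hr].
Qed.

(** By induction on [a], each further factor [y] adds an error of at most [e * |log1 y|]. For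
    [e <= 1] the total error is at most [a * |log1 y|], whence the factor 2 in the radius that keeps
    the powers where [log1_mul] applies. *)
Lemma log1_exp (e : R) : 0 < e -> exists2 r, 0 < r & forall y a,
  chart_dom (1%g : G) y -> 2 * a%:R * `|log1 y| <= r ->
  log_ball (2 * a%:R * `|log1 y|) (y ^+ a)%g /\
  `|log1 (y ^+ a)%g - a%:R *: log1 y| <= e * (a%:R * `|log1 y|).
Proof.
wlog e1 : e / e <= 1 => [wl e0|e0].
  have [||r r0 rP] := wl (Num.min 1 e); first by rewrite ge_min lexx.
    by rewrite lt_min ltr01.
  exists r => // y a yd ya; have [? ye] := rP y a yd ya; split=> //.
  apply: le_trans ye _; apply: ler_wpM2r; last by rewrite ge_min lexx orbT.
  by rewrite mulr_ge0.
have [r r0 rP] := log1_mul e0; exists r => // y a yd.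
elim: a => [_|a IH ya].
  rewrite expg0 log1_1 scale0r subr0 normr0 mulr0 !mul0r mulr0; split=> //.
  by split; [exact: chart_dom_self|rewrite log1_1 normr0].
have N0 := normr_ge0 (log1 y).
have aa : 2 * a%:R * `|log1 y| <= r.
  apply: le_trans ya; apply: ler_wpM2r => //; apply: ler_wpM2l => //.
  by rewrite ler_nat.
have yr : log_ball r y.
  split=> //; apply: le_trans ya; rewrite -[leLHS]mul1r; apply: ler_wpM2r => //.
  by rewrite -natrM ler1n muln_gt0.
have [ar IHe] := IH aa.
have [dm me] := rP _ _ (log_ballW aa ar) yr.
have est : `|log1 (y ^+ a.+1)%g - a.+1%:R *: log1 y| <= e * (a.+1%:R * `|log1 y|).
  rewrite expgSr -natr1 scalerDl scale1r.
  have -> : log1 (y ^+ a * y)%g - (a%:R *: log1 y + log1 y) =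
     (log1 (y ^+ a * y)%g - log1 (y ^+ a)%g - log1 y) +
     (log1 (y ^+ a)%g - a%:R *: log1 y).
    by rewrite (addrAC (log1 (y ^+ a * y)%g) _ (- log1 y)) subrKA opprD addrA addrAC.
  apply: le_trans (ler_normD _ _) _; rewrite mulrDl mul1r mulrDr addrC.
  exact: lerD.
split=> //; split; first by rewrite expgSr.
rewrite -[log1 (y ^+ a.+1)%g](subrK (a.+1%:R *: log1 y)).
apply: le_trans (ler_normD _ _) _.
rewrite normrZ ger0_norm// -mulrA [2]/(1 + 1) mulrDl mul1r lerD2r.
apply: le_trans est _; rewrite -[leRHS]mul1r; apply: ler_wpM2r => //.
by rewrite mulr_ge0.
Qed.

End LieGroup.

(** * Exponentials as limits of powers *)

Section PowerLimits.
Context {R : realType} {n : nat} {G : lieGroupType R n}.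
Variable xi : 'rV[R]_n.

(** [y k] is an approximation of exp(xi / (k+1)); its power [u t k], with exponent the integer part
    of (k+1) t, approximates exp(t xi). *)
Let y (k : nat) : G := chart_inv (1%g : G) (chart (1%g : G) 1%g + k.+1%:R^-1 *: xi).
Let a (k : nat) (t : R) : nat := Num.truncn (k.+1%:R * t).
Let u (t : R) (k : nat) : G := (y k ^+ a k t)%g.

Lemma step_chart_cvg :
  chart (1%g : G) 1%g + k.+1%:R^-1 *: xi @[k --> \oo] --> chart (1%g : G) 1%g.
Proof.
rewrite -[X in _ --> X]addr0 -(scale0r xi); apply: cvgD; first exact: cvg_cst.
by apply: cvgZr_tmp; exact: cvg_harmonic.
Qed.

Lemma step_log1 : \forall k \near \oo,
  chart_dom (1%g : G) (y k) /\ log1 (y k) = k.+1%:R^-1 *: xi.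
Proof.
near=> k.
have yk : chart_im (1%g : G) (chart (1%g : G) 1%g + k.+1%:R^-1 *: xi).
  by near: k; exact: step_chart_cvg _ (chart_im_nbhs (chart_im_self (1%g : G))).
split; first exact: chart_inv_dom.
by rewrite /log1 /y chart_invK// addrC addKr.
Unshelve. all: by end_near. Qed.

(** The term [e * t] comes from [log1_exp]. The other term is a rounding error: the power realizes
    the time [a k t / k.+1], which differs from [t] by at most [k.+1%:R^-1]. *)
Lemma step_small (e : R) : 0 < e -> exists2 d, 0 < d & forall t, 0 <= t <= d ->
  \forall k \near \oo, log_ball e (u t k) /\
    `|log1 (u t k) - t *: xi| <= e * t + k.+1%:R^-1 * `|xi|.
Proof.
move=> e0; have xi0 : 0 < `|xi| + 1 by rewrite ltr_wpDl.
have [r r0 rP] := @log1_exp R n G _ (divr_gt0 e0 xi0).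
(* For [t <= d] the radius in [log1_exp] is at most both [r] and [e]; [|xi| + 1] replaces [|xi|] to
   stay positive when [xi = 0]. *)
pose d := Num.min r e / (2 * (`|xi| + 1)).
have m0 : 0 < Num.min r e by rewrite lt_min r0.
have d0 : 0 < d by rewrite divr_gt0// mulr_gt0.
exists d => // t /andP[t0 td].
near=> k; have [yd yk] : chart_dom (1%g : G) (y k) /\ log1 (y k) = k.+1%:R^-1 *: xi.
  by near: k; exact: step_log1.
have k0 : 0 < k.+1%:R :> R by [].
have /truncn_itv/andP[al au] : 0 <= k.+1%:R * t by rewrite mulr_ge0.
rewrite -/(a k t) in al au.
pose s : R := (a k t)%:R / k.+1%:R.
have s0 : 0 <= s by rewrite divr_ge0.
have st : s <= t by rewrite ler_pdivrMr// mulrC.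
have ts : t - s <= k.+1%:R^-1.
  rewrite -(ler_pM2l k0) mulfV ?gt_eqF// mulrBr mulrCA mulfV ?gt_eqF// mulr1.
  by rewrite lerBlDl natr1 ltW.
have sE : (a k t)%:R * `|log1 (y k)| = s * `|xi|.
  by rewrite yk normrZ ger0_norm ?invr_ge0// mulrA.
have sm : 2 * (a k t)%:R * `|log1 (y k)| <= Num.min r e.
  rewrite -mulrA sE.
  apply: (@le_trans _ _ (2 * (d * (`|xi| + 1)))).
    apply: ler_wpM2l => //; apply: ler_pM => //; last by rewrite lerDl.
    exact: le_trans td.
  suff -> : 2 * (d * (`|xi| + 1)) = Num.min r e by [].
  by rewrite /d; field; rewrite gt_eqF.
have [|ud ue] := rP _ (a k t) yd; first by apply: le_trans sm _; rewrite ge_min lexx.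
rewrite -/(u t k) in ud ue; rewrite sE in ue.
have est : `|log1 (u t k) - s *: xi| <= e * s.
  have -> : s *: xi = (a k t)%:R *: log1 (y k) by rewrite yk scalerA.
  apply: le_trans ue _; rewrite -mulrA; apply: ler_wpM2l; first exact: ltW.
  rewrite mulrC -mulrA ler_piMr// ler_pdivrMr// mul1r.
  by rewrite lerDl.
split.
  by apply: log_ballW ud; apply: le_trans sm _; rewrite ge_min lexx orbT.
rewrite -[t in t *: _](subrK s) scalerDl opprD addrA addrAC.
apply: le_trans (ler_normB _ _) _; apply: lerD.
  by apply: le_trans est _; apply: ler_wpM2l => //; exact: ltW.
by rewrite normrZ ger0_norm ?subr_ge0//; apply: ler_wpM2r.
Unshelve. all: by end_near. Qed.

Lemma step_cvg1 : y k @[k --> \oo] --> (1%g : G).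
Proof.
exact: cvg_comp step_chart_cvg (@chart_inv_self_continuous _ _ _ (1%g : G)).
Qed.

(** Integer parts are additive up to a carry [b]. In the limit the carry is harmless, since it
    contributes at most one factor [y k], which tends to 1. *)
Lemma step_count_add (s t : R) k : 0 <= s -> 0 <= t ->
  exists b : bool, a k (s + t) = (a k s + a k t + b)%N.
Proof.
move=> s0 t0; have k0 : 0 < k.+1%:R :> R by [].
have /truncn_itv/andP[] : 0 <= k.+1%:R * s by rewrite mulr_ge0.
have /truncn_itv/andP[] : 0 <= k.+1%:R * t by rewrite mulr_ge0.
have /truncn_itv/andP[] : 0 <= k.+1%:R * (s + t) by rewrite mulr_ge0// addr_ge0.
rewrite -!/(a k _); set A := a k s; set B := a k t; set C := a k (s + t).
rewrite mulrDr -!natr1 => C1 C2 B1 B2 A1 A2.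
have CAB : (C < (A + B).+2)%N.
  by rewrite -(ltr_nat R) -!natr1 natrD; lra.
have ABC : (A + B < C.+1)%N.
  by rewrite -(ltr_nat R) -!natr1 natrD; lra.
exists (A + B < C)%N; lia.
Qed.

(* [phi t] is the limit of [u t] along an ultrafilter; it exists for small [t] because
   [step_small] keeps [u t k] in a compact ball, and then for all [t] by addition. *)
Lemma half_line : exists phi : R -> G,
  (forall s t, 0 <= s -> 0 <= t -> phi (s + t) = (phi s * phi t)%g) /\
  (forall e, 0 < e -> exists2 d, 0 < d & forall t, 0 <= t <= d ->
     log_ball e (phi t) /\ `|log1 (phi t) - t *: xi| <= e * t).
Proof.
(* A single ultrafilter finer than convergence at infinity serves all times at once, so the limits
   at [s], [t] and [s + t] are compatible. *)
have [F [FU FO]] := ultraFilterLemma eventually_filter.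
pose lim_at (t : R) (p : G) := u t @ F --> p.
have lim_unique t p q : lim_at t p -> lim_at t q -> p = q.
  exact: (cvg_unique (@manifold_hausdorff R n G)).
have limD s t p q : 0 <= s -> 0 <= t -> lim_at s p -> lim_at t q ->
    lim_at (s + t) (p * q)%g.
  move=> s0 t0 sp tq.
  have [b bE] := choice (fun k => step_count_add k s0 t0).
  rewrite /lim_at; have -> : u (s + t) = (fun k => u s k * u t k * y k ^+ b k)%g.
    by apply/funext => k; rewrite /u bE !expgnDr.
  rewrite -[(p * q)%g]mulg1; apply: mulg_cvg; first exact: mulg_cvg.
  move=> O O1; have : \forall k \near F, O (y k) by apply: FO; exact: step_cvg1.
  apply: filterS => k yk; rewrite /= expgb; case: (b k) => //.
  exact: nbhs_singleton O1.
have [r r0 [K Kc [rK Kdom]]] := @log_ball_compact R n G.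
have lim_small e : 0 < e -> e <= r -> exists2 d, 0 < d & forall t, 0 <= t <= d ->
    exists2 p, lim_at t p & log_ball e p /\ `|log1 p - t *: xi| <= e * t.
  move=> e0 er; have [d d0 dP] := step_small e0; exists d => // t td.
  have {}dP : \forall k \near F, log_ball e (u t k) /\
      `|log1 (u t k) - t *: xi| <= e * t + k.+1%:R^-1 * `|xi|.
    by apply: FO; exact: dP.
  have [|p /Kdom pd pt] := @ultra_cvg_compact _ F _ (u t) K FU Kc.
    by apply: filterS dP => k [ue _]; apply: rK; exact: log_ballW ue.
  exists p => //.
  have lp : log1 (u t k) @[k --> F] --> log1 p.
    by apply: cvgB; [exact: cvg_comp pt (chart_continuous _ _ pd)|exact: cvg_cst].
  split.
    split=> //; apply: (ler_cvg_to (cvg_norm lp) (cvg_cst e)).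
    by apply: filterS dP => k [[_ ?] _].
  have lpt : log1 (u t k) - t *: xi @[k --> F] --> log1 p - t *: xi.
    by apply: cvgB => //; exact: cvg_cst.
  have bt : e * t + k.+1%:R^-1 * `|xi| @[k --> F] --> e * t.
    rewrite -[X in _ --> X]addr0 -(mul0r `|xi|); apply: cvgD; first exact: cvg_cst.
    apply: cvgMl; apply: cvg_trans (@cvg_harmonic R).
    by move=> A; exact: FO.
  apply: (ler_cvg_to (cvg_norm lpt) bt).
  by apply: filterS dP => k [].
have lim_all t : exists p, 0 <= t -> lim_at t p.
  have [t0|t0] := leP 0 t; last by exists 1%g.
  have [d d0 dP] := lim_small _ r0 (lexx r).
  (* The successor gives [t / m <= d]; the limit at [t] is then the [m]-th power of the limit at the
     small time [t / m]. *)
  pose m := (Num.truncn (t / d)).+1.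
  have m0 : 0 < m%:R :> R by [].
  pose s := t / m%:R.
  have s0 : 0 <= s by rewrite divr_ge0.
  have [|p sp _] := dP s.
    rewrite s0 ler_pdivrMr// -ler_pdivrMl// mulrC.
    by have /truncn_itv/andP[_ /ltW] : 0 <= t / d by rewrite divr_ge0// ltW.
  exists (p ^+ m)%g => _.
  have -> : t = m%:R * s by rewrite mulrC divfK// gt_eqF.
  elim: (m) => [|j IH].
    rewrite mul0r expg0 /lim_at.
    have -> : u 0 = fun=> 1%g.
      by apply/funext => k; rewrite /u /a mulr0 truncn0 expg0.
    exact: cvg_cst.
  by rewrite -natr1 mulrDl mul1r expgSr; apply: limD => //; rewrite mulr_ge0.
have [phi phiP] := choice lim_all.
exists phi; split=> [s t s0 t0|e e0].
  by apply: (@lim_unique (s + t)); [apply: phiP; rewrite addr_ge0|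
    apply: limD => //; exact: phiP].
have m0 : 0 < Num.min e r by rewrite lt_min e0.
have [|d d0 dP] := lim_small _ m0; first by rewrite ge_min lexx orbT.
have me : Num.min e r <= e by rewrite ge_min lexx.
exists d => // t td; have [p tp [pe pt]] := dP t td.
have /andP[t0 _] := td.
rewrite (lim_unique t (phi t) p)//; last exact: phiP.
split; first exact: log_ballW pe.
by apply: le_trans pt _; apply: ler_wpM2r.
Qed.

End PowerLimits.

Section OneParameterSubgroup.
Context {R : realType} {n : nat} {G : lieGroupType R n}.

(** The half-line homomorphism is extended by inverses to negative times. Its values commute because
    addition of times does, and the estimates near 0 give the velocity. *)
Lemma one_parameter_subgroup (xi : 'rV[R]_n) : exists gamma : R -> G,
  (forall s t, gamma (s + t) = (gamma s * gamma t)%g) /\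
  has_velocity gamma 0 xi.
Proof.
have [phi [phiD phi_small]] := @half_line R n G xi.
have phi0 : phi 0 = 1%g.
  by apply: (@mulgI G (phi 0)); rewrite -phiD// addr0 mulg1.
have phiC s t : 0 <= s -> 0 <= t -> commute (phi s) (phi t).
  by move=> s0 t0; rewrite /commute -!phiD// addrC.
pose gamma t := if 0 <= t then phi t else ((phi (- t))^-1)%g.
have gammaB s t : 0 <= s -> 0 <= t -> gamma (s - t) = (phi s * (phi t)^-1)%g.
  move=> s0 t0; rewrite /gamma subr_ge0; case: leP => [ts|st].
    by rewrite -[s in RHS](subrK t) (phiD (s - t)) ?subr_ge0// mulgK.
  rewrite opprB -[t in RHS](subrK s) (phiD (t - s)) ?subr_ge0 ?(ltW st)//.
  by rewrite invgM mulVKg.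
(* Writing each time as a difference of nonnegative ones reduces additivity to [gammaB], without a
   discussion of signs. *)
have posneg (s : R) : exists p q, [/\ 0 <= p, 0 <= q & s = p - q].
  have [s0|s0] := leP 0 s; first by exists s, 0; rewrite subr0.
  by exists 0, (- s); split; rewrite ?sub0r ?opprK ?oppr_ge0 ?(ltW s0).
have gammaD s t : gamma (s + t) = (gamma s * gamma t)%g.
  have [p [q [p0 q0 ->]]] := posneg s; have [p' [q' [p0' q0' ->]]] := posneg t.
  rewrite addrACA -opprD !gammaB ?addr_ge0//.
  rewrite (addrC q) !phiD// invgM !mulgA; congr (_ * _)%g; rewrite -!mulgA; congr (_ * _)%g.
  by rewrite (commuteV (phiC p' q p0' q0)).
have small e : 0 < e -> exists2 d, 0 < d & forall t, `|t| <= d ->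
    chart_dom (1%g : G) (gamma t) /\ `|log1 (gamma t) - t *: xi| <= e * `|t|.
  move=> e0.
  have e20 : 0 < e / 2 by rewrite divr_gt0.
  have X0 : 0 < `|xi| + e / 2 by rewrite ltr_wpDl.
  (* By [log1_mul] for [g^-1 * g = 1], inversion is negation in coordinates up to [e1 * |log1 g|].
     As [|log1 g|] is at most [(|xi| + e / 2) * |t|], this costs at most [e / 2 * |t|]. *)
  pose e1 := e / 2 / (`|xi| + e / 2).
  have e10 : 0 < e1 by rewrite divr_gt0.
  have [r r0 rP] := @log1_mul R n G _ e10.
  have : nbhs (1%g : G) [set g | log_ball r (g^-1)%g].
    apply: (@invg_cvg R n G _ (nbhs (1%g : G)) id 1%g) => //.
    by rewrite invg1; exact: log_ball_nbhs.
  move=> /log_ball_sub[r' r'0 r'P].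
  have [d d0 dP] := phi_small (e / 2) e20.
  have m0 : 0 < Num.min r r' by rewrite lt_min r0.
  have [d' d'0 dP'] := phi_small _ m0.
  exists (Num.min d d'); first by rewrite lt_min d0.
  move=> t; rewrite le_min => /andP[td td'].
  have [ball_t est_t] : log_ball (Num.min r r') (phi `|t|) /\
      `|log1 (phi `|t|) - `|t| *: xi| <= e / 2 * `|t|.
    have [|_ ?] := dP `|t|; first by rewrite normr_ge0.
    by have [|] := dP' `|t|; first by rewrite normr_ge0.
  rewrite /gamma; case: leP => t0.
    rewrite ger0_norm// in ball_t est_t *; split; first by case: ball_t.
    by apply: le_trans est_t _; apply: ler_wpM2r => //; lra.
  rewrite ltr0_norm// in ball_t est_t *.
  have br : log_ball r (phi (- t)).
    by apply: log_ballW ball_t; rewrite ge_min lexx.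
  have br' : log_ball r (phi (- t))^-1%g.
    by apply: r'P; apply: log_ballW ball_t; rewrite ge_min lexx orbT.
  split; first by case: br'.
  have [_] := rP _ _ br' br.
  rewrite mulVg log1_1 sub0r => inv_est.
  have size_t : `|log1 (phi (- t))| <= (`|xi| + e / 2) * - t.
    rewrite -[log1 _](subrK (- t *: xi)) addrC; apply: le_trans (ler_normD _ _) _.
    by rewrite mulrDl; apply: lerD => //; rewrite normrZ gtr0_norm ?oppr_gt0// mulrC.
  have -> : log1 (phi (- t))^-1%g - t *: xi =
      - (- log1 (phi (- t))^-1%g - log1 (phi (- t))) - (log1 (phi (- t)) - - t *: xi).
    by rewrite scaleNr opprK opprB opprK opprD addrA [in RHS](addrC (log1 _)) addrK.
  apply: le_trans (ler_normB _ _) _; rewrite normrN.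
  have -> : e * - t = e1 * ((`|xi| + e / 2) * - t) + e / 2 * - t.
    rewrite /e1; field; apply: lt0r_neq0.
    by have := normr_ge0 xi; lra.
  apply: lerD est_t; apply: le_trans inv_est _.
  by apply: ler_wpM2l => //; exact: ltW.
have gamma0 : gamma 0 = 1%g by rewrite /gamma lexx.
have dom0 : \forall t \near (0 : R), chart_dom (1%g : G) (gamma t).
  have [d d0 dP] := small 1 ltr01.
  apply/nbhs_ballP; exists d => // t.
  by rewrite -ball_normE/= sub0r normrN => /ltW/dP[].
have der : is_derive (0 : R) (1 : R) (chart (gamma 0) \o gamma) xi.
  have cv : h^-1 *: (((chart (gamma 0) \o gamma) \o shift 0) (h *: (1 : R)) -
        (chart (gamma 0) \o gamma) 0)
      @[h --> (0 : R)^'] --> xi.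
    apply/cvgrPdist_le => e e0; have [d d0 dP] := small e e0.
    near=> h.
    have h0 : h != 0 by near: h; exact: nbhs_dnbhs_neq.
    have hd : `|h| <= d by near: h; exact: dnbhs0_le.
    have [_ he] := dP h hd.
    rewrite /= addr0 [h *: 1]mulr1 gamma0 -/(log1 (gamma h)).
    rewrite -[xi](scalerK h0) -scalerBr normrZ normfV ler_pdivrMl ?normr_gt0//.
    by rewrite distrC mulrC.
  by apply: DeriveDef; [apply/cvg_ex; exists xi|exact: cvg_lim cv].
exists gamma; split=> //; split=> //.
have [dg _] := der.
have /differentiable_continuous cg : differentiable (chart (gamma 0) \o gamma) (0 : R).
  exact/derivable1_diffP.
have : (chart_inv (gamma 0) \o (chart (gamma 0) \o gamma)) t @[t --> (0 : R)] --> gamma 0.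
  exact: cvg_comp cg (@chart_inv_self_continuous _ _ _ (gamma 0)).
apply: cvg_trans; apply: near_eq_cvg; near=> t.
by rewrite /= chartK// gamma0; near: t.
Unshelve. all: by end_near. Qed.

End OneParameterSubgroup.

(** * Infinitesimal actions and momentum maps *)

Section ConstantCurves.
Context {R : realType}.

Lemma is_derive_translate (V : normedModType R) (f : R -> V) (s : R) v :
  is_derive (0 : R) (1 : R) f v -> is_derive s (1 : R) (fun t => f (t - s)) v.
Proof.
have E : (fun h : R => h^-1 *: (((fun t => f (t - s)) \o shift s) (h *: (1 : R)) - f (s - s))) =
    (fun h : R => h^-1 *: ((f \o shift 0) (h *: (1 : R)) - f 0)).
  by apply/funext => h; rewrite /= addrK addr0 subrr.
by move=> [df dv]; apply: DeriveDef; rewrite /derivable /derive E.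
Qed.

Lemma is_derive_0_cst_mx m n (f : R -> 'M[R]_(m, n)) :
  (forall t, is_derive t (1 : R) f 0) -> forall s t, f s = f t.
Proof.
move=> f0 s t; apply/matrixP => i j.
apply: (@is_derive_0_is_cst R (fun t => f t i j)) => x.
by have := is_derive_coord i j (f0 x); rewrite mxE.
Qed.

End ConstantCurves.

Section Pairing.
Context {R : realType} {n : nat}.
Implicit Types (mu : 'cV[R]_n) (xi : 'rV[R]_n).

Lemma pairing_eq0 mu : (forall xi, pairing mu xi = 0) -> mu = 0.
Proof.
move=> mu0; apply/colP => i; have := mu0 (delta_mx 0 i).
by rewrite /pairing -rowE !mxE.
Qed.

End Pairing.

Section HamiltonianField.
Context {R : realType} {d : nat} {P : manifoldType R d}.
Variables (omega : P -> 'rV[R]_d -> 'rV[R]_d -> R) (homega : symplectic_form omega).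

Lemma symplectic_sumr p u v :
  omega p u v = \sum_j v 0 j * omega p u (delta_mx 0 j).
Proof.
have om0 w : omega p 0 w = 0.
  have := symplectic_linear homega p 1 0 0 w.
  by rewrite scaler0 addr0 mul1r => /eqP; rewrite -subr_eq0 opprD addNKr oppr_eq0 => /eqP.
rewrite (symplectic_skew homega) {1}[v]row_sum_delta.
transitivity (- \sum_j v 0 j * omega p (delta_mx 0 j) u); last first.
  by rewrite -sumrN; apply: eq_bigr => j _; rewrite (symplectic_skew homega p u) mulrN.
congr (- _); elim/big_rec2 : _ => [|j x y _ <-]; first exact: om0.
by rewrite (symplectic_linear homega).
Qed.

(** Nondegeneracy makes [u |-> omega p u] injective, hence bijective onto the dual by equality of
    dimensions, so [xget] does not return its default value. *)
Lemma hamiltonian_fieldP (H : P -> R) p v :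
  omega p (hamiltonian_field omega H p) v = differential H p v.
Proof.
suff [u uH] : exists u, forall v, omega p u v = differential H p v.
  by rewrite /hamiltonian_field; case: xgetP => [w _|/(_ u)]; exact.
pose f u : 'rV[R]_d := \row_j omega p u (delta_mx 0 j).
have f_lin : linear f.
  by move=> a u w; apply/rowP => j; rewrite !mxE (symplectic_linear homega).
pose F : {linear 'rV[R]_d -> 'rV[R]_d} :=
  HB.pack f (GRing.isLinear.Build _ _ _ _ _ f_lin).
have F_unit : lin1_mx F \in unitmx.
  rewrite -row_free_unit; apply: inj_row_free => u; rewrite mul_rV_lin1 => fu0.
  apply: (symplectic_nondegenerate homega (p := p)) => w.
  rewrite symplectic_sumr big1// => j _; have /rowP/(_ j) := fu0.
  by rewrite !mxE => ->; rewrite mulr0.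
exists ((\row_j differential H p (delta_mx 0 j)) *m invmx (lin1_mx F)) => w.
set u := _ *m _.
have fu : f u = \row_j differential H p (delta_mx 0 j).
  by rewrite -[LHS]/(F u) -mul_rV_lin1 /u mulmxKV.
rewrite symplectic_sumr {2}[w]row_sum_delta linear_sum; apply: eq_bigr => j _.
by rewrite linearZ/=; have /rowP/(_ j) := fu; rewrite !mxE => ->.
Qed.

End HamiltonianField.

Section GroupActions.
Context {R : realType} {n d : nat} {G : lieGroupType R n} {P : manifoldType R d}.
Variables (act : G -> P -> P) (hact : smooth_action act).

Lemma homo_one (gamma : R -> G) :
  (forall s t, gamma (s + t) = (gamma s * gamma t)%g) -> gamma 0 = 1%g.
Proof. by move=> gD; apply: (@mulgI G (gamma 0)); rewrite -gD addr0 mulg1. Qed.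

Lemma homo_opp (gamma : R -> G) t :
  (forall s t, gamma (s + t) = (gamma s * gamma t)%g) ->
  gamma (- t) = ((gamma t)^-1)%g.
Proof.
move=> gD; apply: (@mulgI G (gamma t)).
by rewrite -gD subrr homo_one// mulgV.
Qed.

Lemma has_velocity_orbit (gamma : R -> G) xi p :
  (forall s t, gamma (s + t) = (gamma s * gamma t)%g) ->
  has_velocity gamma 0 xi ->
  has_velocity (fun t => act (gamma t) p) 0 (inf_action act xi p).
Proof.
move=> gD gv; have [_ _ acts] := hact.
have [d_act _] := smooth2_diff_at_l acts 1%g p.
rewrite -(homo_one gD) in d_act.
have := has_velocity_comp gv d_act.
by rewrite (homo_one gD).
Qed.

(* If [xi] acts trivially at [p], then [t |-> exp(t xi) p] has velocity 0 at all times by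
   equivariance, so it is locally constant and freeness gives [exp(t xi) = 1]. *)
Lemma inf_action_inj p xi : free_action act -> inf_action act xi p = 0 -> xi = 0.
Proof.
move=> hfree xi0; have [act1 actM acts] := hact.
have [gamma [gD gv]] := @one_parameter_subgroup R n G xi.
pose c t := act (gamma t) p.
have c0 : has_velocity c 0 0 by rewrite -xi0; exact: has_velocity_orbit.
have cs s : has_velocity c s 0.
  have -> : c = (fun t => (act (gamma s) \o c) (t - s)).
    by apply/funext => t; rewrite /c/= -actM -gD addrC subrK.
  have [d_act _] := smooth2_diff_at_r acts (gamma s) (c 0).
  have := has_velocity_comp c0 d_act; rewrite linear0 => -[cc dc].
  split; last first.
    rewrite -[X in is_derive _ _ X _]/(fun t =>
      (chart ((act (gamma s) \o c) (s - s)) \o (act (gamma s) \o c)) (t - s)).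
    by rewrite (subrr s); exact: is_derive_translate.
  have tc : t - s @[t --> s] --> (0 : R).
    by rewrite -(subrr s); apply: cvgB; [exact: cvg_id|exact: cvg_cst].
  suff : (act (gamma s) \o c) (t - s) @[t --> s] --> (act (gamma s) \o c) (s - s) by [].
  by rewrite (subrr s); exact: cvg_comp tc cc.
have /locally_constant_curve c_cst : \forall t \near (0 : R), has_velocity c t 0.
  by near=> t; exact: cs.
have g1 : \forall t \near (0 : R), gamma t = gamma 0.
  apply: filterS c_cst => t; rewrite /c (homo_one gD) act1; exact: hfree.
have [_ [_ <-]] := gv.
rewrite (@near_eq_derive _ _ _ _ (cst (chart (gamma 0) (gamma 0)))) ?derive_cst//.
by apply: filterS g1 => t /= ->.
Unshelve. all: by end_near. Qed.

Variable (J : P -> 'cV[R]_n).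
Hypotheses (hJs : smooth_fun J) (hJequiv : equivariant_momentum act J).

(** The vector [dJ (xi p)] is the velocity at 0 of [t |-> J (exp(t xi) p)]. By equivariance the
    velocity of this curve at time [s] is the image under a coadjoint map of that at 0, so the curve
    is constant as soon as the latter vanishes. *)
Lemma Lie_algebra_isotropy p xi :
  Lie_algebra_of (@coAd_isotropy R n G (J p)) xi <->
  differential J p (inf_action act xi p) = 0.
Proof.
have [act1 actM acts] := hact.
have derJ gamma : (forall s t, gamma (s + t) = (gamma s * gamma t)%g) ->
    has_velocity gamma 0 xi ->
    is_derive (0 : R) (1 : R) (J \o (fun t => act (gamma t) p))
      (differential J p (inf_action act xi p)).
  move=> gD gv; have := is_derive_smooth_fun hJs (has_velocity_orbit p gD gv).
  by rewrite (homo_one gD) act1.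
split=> [[gamma [gD gv gK]]|xi0].
  have [_ <-] := derJ gamma gD gv.
  rewrite (_ : J \o _ = cst (J p)) ?derive_cst//.
  apply/funext => t /=; rewrite hJequiv -homo_opp//; exact: gK.
have [gamma [gD gv]] := @one_parameter_subgroup R n G xi.
exists gamma; split=> // t.
pose j := J \o (fun t => act (gamma t) p).
have j0 : is_derive (0 : R) (1 : R) j 0 by rewrite -xi0; exact: derJ.
have js s : is_derive s (1 : R) j 0.
  pose A : {linear 'cV[R]_n -> 'cV[R]_n} := mulmx (lin1_mx (Ad (gamma s)^-1%g)).
  have -> : j = (fun t => (A \o j) (t - s)).
    apply/funext => u; rewrite /j/= -[mulmx _ _]/(coAd _ _) -hJequiv -actM -gD.
    by rewrite addrC subrK.
  apply: (@is_derive_translate _ _ (A \o j)).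
  have Ad : differentiable A (j 0).
    by apply: linear_differentiable; apply: finite_basis_linear_continuous; exact: finite_basis_mx.
  by have := is_derive_comp j0 Ad; rewrite linear0.
have := is_derive_0_cst_mx js (- t) 0.
by rewrite /j/= (homo_one gD) act1 hJequiv (homo_opp t gD) invgK.
Qed.

Variable (omega : P -> 'rV[R]_d -> 'rV[R]_d -> R).
Hypotheses (homega : symplectic_form omega) (hJ : momentum_map omega act J).

(** Along the flow, the component of [J] on [xi] has derivative [omega (xi p, X_H) = - dH (xi p)],
    which is 0 by invariance of [H]. *)
Lemma noether (H : P -> R) p c : invariant_hamiltonian act H ->
  flow_line (hamiltonian_field omega H) p c -> forall t, J (c t) = J p.
Proof.
move=> [Hs Hinv] [c0 cv] t; have [act1 actM acts] := hact.
have [_ Jomega] := hJ.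
rewrite -c0; apply: (@is_derive_0_cst_mx _ _ _ (J \o c)) => s.
have := is_derive_smooth_fun hJs (cv s).
suff -> : differential J (c s) (hamiltonian_field omega H (c s)) = 0 by [].
apply: pairing_eq0 => xi; rewrite -Jomega (symplectic_skew homega).
rewrite (hamiltonian_fieldP homega) /inf_action.
have [d_act _] := smooth2_diff_at_l acts 1%g (c s).
have := @differential_cst_comp _ _ _ _ _ _ H _ _ xi (H (c s)) d_act Hs (fun g => Hinv g (c s)).
by rewrite act1 => ->; rewrite oppr0.
Qed.

Lemma inf_action_pairing_skew p xi eta :
  pairing (differential J p (inf_action act xi p)) eta =
  - pairing (differential J p (inf_action act eta p)) xi.
Proof.
by have [_ Jomega] := hJ; rewrite -!Jomega (symplectic_skew homega).
Qed.

End GroupActions.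

(** * Slices *)

Section ContractionSolve.
Context {R : realType}.

(* A minimizer [y] of [|F y p|] on a small ball is a zero, since the Newton step
   [y - F y p] stays in the ball and at least halves [|F y p|]. *)
Lemma solve_near_identity n (T : topologicalType) (F : 'rV[R]_n -> T -> 'rV[R]_n)
    (y0 : 'rV[R]_n) (p0 : T) (rho : R) : 0 < rho ->
  (\forall p \near p0, forall y z, `|y - y0| <= rho -> `|z - y0| <= rho ->
     `|F z p - F y p - (z - y)| <= 2^-1 * `|z - y|) ->
  F y0 p @[p --> p0] --> (0 : 'rV[R]_n) ->
  forall eta, 0 < eta ->
    \forall p \near p0, exists2 y, `|y - y0| <= eta & F y p = 0.
Proof.
move=> rho0 Flip F0 eta eta0; pose m := Num.min (rho / 2) eta.
have rho2 : 0 < rho / 2 by rewrite divr_gt0.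
have m0 : 0 < m by rewrite lt_min rho2.
have mrho : m <= rho / 2 by rewrite ge_min lexx.
have meta : m <= eta by rewrite ge_min lexx orbT.
have m20 : 0 < 2^-1 * m by rewrite mulr_gt0// invr_gt0.
near=> p.
have Fp y z : `|y - y0| <= rho -> `|z - y0| <= rho ->
    `|F z p - F y p - (z - y)| <= 2^-1 * `|z - y|.
  by move: y z; near: p.
(* Half of [m] is allotted to the value at [y0] and half to the contraction error, so that the
   Newton step stays in the ball of radius [m]. *)
have F0p : `|F y0 p| <= 2^-1 * m.
  by near: p; move/cvgr0_norm_le : F0; exact.
have mle y : `|y - y0| <= m -> `|y - y0| <= rho.
  by move=> ym; apply: le_trans ym _; apply: le_trans mrho _; lra.
pose C := [set y | `|y - y0| <= m].
have Fc : {within C, continuous (fun y => `|F y p|)}.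
  apply: continuous_in_subspaceT => y; rewrite inE/= => yC.
  apply: (@continuous_comp _ _ _ (F^~ p) Num.norm); last exact: norm_continuous.
  apply: (@near_lipschitz_continuous _ _ _ _ _ 2) => //.
  apply: filterS (near_dist_le y rho2) => z zy.
  have zr : `|z - y0| <= rho.
    rewrite -(subrKA y); apply: le_trans (ler_normD _ _) _.
    by apply: le_trans (lerD zy (le_trans yC mrho)) _; lra.
  rewrite -[F z p - F y p](subrK (z - y)); apply: le_trans (ler_normD _ _) _.
  by have := Fp _ _ (mle _ yC) zr; have := normr_ge0 (z - y); lra.
have [||y yC ymin] := @compact_EVT_min _ R (fun y => `|F y p|) C _ _ Fc.
- by exists y0; rewrite /C/= subrr normr0 ltW.
- exact: compact_norm_ball.
rewrite inE/= in yC.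
have y0r : `|y0 - y0| <= rho by rewrite subrr normr0 ltW.
pose z := y - F y p.
have zC : `|z - y0| <= m.
  have -> : z - y0 = - (F y p - F y0 p - (y - y0)) - F y0 p.
    by apply/matrixP => i j; rewrite !mxE; ring.
  apply: le_trans (ler_normB _ _) _; rewrite normrN.
  by have := Fp _ _ y0r (mle _ yC); rewrite /C/= in yC; lra.
have := ymin z; rewrite inE => /(_ zC).
have := Fp _ _ (mle _ yC) (mle _ zC).
have -> : z - y = - F y p by rewrite /z addrAC subrr add0r.
rewrite opprK subrK normrN => Fz Fy.
exists y; first exact: le_trans meta.
by apply/eqP; rewrite -normr_le0; lra.
Unshelve. all: by end_near. Qed.

End ContractionSolve.

(** * Transporters of proper actions *)

Section ProperActions.
Context {R : realType} {n d : nat} {G : lieGroupType R n} {P : manifoldType R d}.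
Variables (act : G -> P -> P).
Hypotheses (hact : smooth_action act) (hproper : proper_action act).

(** The set is the image under [(g, p) |-> (g p, p)] of a closed part of the preimage of [K], and
    this preimage is compact by properness. *)
Lemma compact_moved (K : set (P * P)) (O : set G) : compact K -> open O ->
  compact [set z | K z /\ exists2 g, ~ O g & act g z.2 = z.1].
Proof.
move=> Kc Oo; have [_ _ [actc _]] := hact.
pose f (z : G * P) := (act z.1 z.2, z.2).
have fc : continuous f.
  by move=> z; apply: cvg_pair; [exact: actc|exact: cvg_snd].
have -> : [set z | K z /\ exists2 g, ~ O g & act g z.2 = z.1] =
    f @` (f @^-1` K `&` fst @^-1` (~` O)).
  apply/seteqP; split=> [[q p]/= [Kqp [g Og gp]]|_ [[g p]/= [Kp Og] <-]].
    by exists (g, p) => //; rewrite /f/= gp.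
  by split=> //; exists g.
apply: continuous_compact; first exact: continuous_subspaceT.
apply: compact_closedI; first exact: hproper.
by apply: closed_comp; [move=> z _; exact: cvg_fst|exact: open_closedC].
Qed.

(** Inside a compact neighbourhood of [p], the points moved into [S] by some [g] outside [O] form a
    projection of a compact set, hence a closed set, and [p] is not in it. This semicontinuity later
    makes [tau] continuous. *)
Lemma transporter_near (S : set P) (p : P) (O : set G) : compact S -> open O ->
  (forall g, S (act g p) -> O g) ->
  \forall q \near p, forall g, S (act g q) -> O g.
Proof.
move=> Sc Oo SO; have [Q [Qc pQ _]] := compact_nbhs (filterT : nbhs p setT).
pose T := [set z : P * P | (S `*` Q) z /\ exists2 g, ~ O g & act g z.2 = z.1].
have Tc : compact T by apply: compact_moved => //; exact: compact_setX.
have T2 : closed (snd @` T).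
  apply: compact_closed; first exact: manifold_hausdorff.
  by apply: continuous_compact => //; apply: continuous_subspaceT => z; exact: cvg_snd.
have pT : ~ (snd @` T) p.
  move=> [[q p']/= [[/= Sq _] [g Og gp]] pp']; apply: Og; apply: SO.
  by rewrite -pp' gp.
have pTn : nbhs p (~` (snd @` T)).
  by apply: open_nbhs_nbhs; split=> //; exact: closed_openC.
near=> q => g Sg; apply: contrapT => Og.
have : (~` (snd @` T)) q by near: q.
apply; exists (act g q, q) => //; split; last by exists g.
by split=> //=; near: q.
Unshelve. all: by end_near. Qed.

Hypothesis hfree : free_action act.

(** By freeness, no [g] outside [O'] fixes [p]; properness then gives a compact neighbourhood [B1]
    into which no such [g] moves [p], and [transporter_near] extends this to the points near [p]. *)
Lemma near_same_point (p : P) (O : set G) : nbhs (1%g : G) O ->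
  exists2 B, nbhs p B & forall q g, B q -> B (act g q) -> O g.
Proof.
rewrite nbhsE => -[O' [Oo O1] O'O].
have [B0 [B0c pB0 _]] := compact_nbhs (filterT : nbhs p setT).
pose T := [set z : P * P | (B0 `*` [set p]) z /\ exists2 g, ~ O' g & act g z.2 = z.1].
have Tc : compact T.
  by apply: compact_moved => //; apply: compact_setX => //; exact: compact_set1.
have T1 : closed (fst @` T).
  apply: compact_closed; first exact: manifold_hausdorff.
  by apply: continuous_compact => //; apply: continuous_subspaceT => z; exact: cvg_fst.
have pT : nbhs p (~` (fst @` T)).
  apply: open_nbhs_nbhs; split; first exact: closed_openC.
  move=> [[q p']/= [[/= _ ->] [g Og gp]] qp]; apply: Og.
  by rewrite (hfree (g := g) (p := p)) // gp.
have [B1 [B1c pB1 B1T]] := compact_nbhs (filterI pB0 pT).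
have pB2 : \forall q \near p, forall g, B1 (act g q) -> O' g.
  apply: transporter_near => // g B1g.
  apply: contrapT => Og; have [B0g] := B1T _ B1g; apply.
  by exists (act g p, p) => //; split=> //; exists g.
exists (B1 `&` [set q | forall g : G, B1 (act g q) -> O' g]); first exact: filterI.
by move=> q g [_ Bq] [B1g _]; apply: O'O; exact: Bq.
Qed.

End ProperActions.

(** * Slices as zero sets *)

Section LocalSlice.
Context {R : realType} {n d : nat} {G : lieGroupType R n} {P : manifoldType R d}.
Variables (act : G -> P -> P).
Hypotheses (hact : smooth_action act) (hproper : proper_action act)
  (hfree : free_action act).

(** In charts, [theta (g p)] is strictly differentiable in [(g, p)] jointly, with partial derivative
    the identity in [g]. Comparing two pairs with the same [p] gives an estimate uniform in [p]. *)
Lemma slice_estimate (pe : P) (theta : 'rV[R]_d -> 'rV[R]_n)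
    (T : {linear 'rV[R]_d -> 'rV[R]_n}) :
  strict_diff theta (chart pe pe) T ->
  (forall xi, T (inf_action act xi pe) = xi) ->
  exists2 rho, 0 < rho &
    \forall p \near pe, forall y z,
      `|y - chart (1%g : G) 1%g| <= rho -> `|z - chart (1%g : G) 1%g| <= rho ->
      `|theta (chart pe (act (chart_inv (1%g : G) z) p)) -
        theta (chart pe (act (chart_inv (1%g : G) y) p)) - (z - y)| <=
      2^-1 * `|z - y|.
Proof.
move=> theta_s T_inf; have [act1 _ acts] := hact.
set o := chart (1%g : G) 1%g; set x0 := chart pe pe.
have [/nbhs_singleton] := smooth2_strict_diff acts 1%g pe.
have [_] := smooth2_diff_at_l acts 1%g pe.
have A0 : in_charts act (1%g : G) pe (o, x0) = x0.
  by rewrite /in_charts/= !chartK_self act1.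
pose A := in_charts act (1%g : G) pe; rewrite -/A in A0 *.
move=> DE dA sA; rewrite -/o -/x0 in DE dA sA.
have Ac := differentiable_continuous dA.
have DA := linear_lipschitz (diff_continuous dA).
rewrite -/x0 -A0 in theta_s.
have Tc : continuous T by apply: finite_basis_linear_continuous; exact: finite_basis_mx.
have half : 0 < 2^-1 :> R by rewrite invr_gt0.
have [[Q1 Q2] /= [[[Y1 X1] /= [Y1n X1n] YX1] [[Y2 X2] /= [Y2n X2n] YX2]] Q12] :=
  strict_diff_comp Ac Tc DA sA theta_s half.
have /nbhs_ballP[r /= r0 rY] : nbhs o (Y1 `&` Y2) by exact: filterI.
exists (r / 2); first by rewrite divr_gt0.
near=> p => y z yr zr.
have pd : chart_dom pe p by near: p; exact/chart_dom_nbhs/chart_dom_self.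
have [X1p X2p] : (X1 `&` X2) (chart pe p).
  by near: p; apply: chart_self_continuous; exact: filterI.
have inY w : `|w - o| <= r / 2 -> (Y1 `&` Y2) w.
  move=> wr; apply: rY; rewrite -ball_normE/= distrC; apply: le_lt_trans wr _; lra.
have AE w : A (w, chart pe p) = chart pe (act (chart_inv (1%g : G) w) p).
  by rewrite /A /in_charts/= act1 chartK.
have := Q12 ((y, chart pe p), (z, chart pe p)).
rewrite /= !AE.
have -> : (z, chart pe p) - (y, chart pe p) = (z - y, 0).
  by rewrite -[LHS]/(z - y, chart pe p - chart pe p) subrr.
rewrite -DE T_inf norm_pair normr0 (max_idPl _)//.
apply; split; [apply: YX1|apply: YX2]; split=> //=.
  by have [] := inY y yr.
by have [] := inY z zr.
Unshelve. all: by end_near. Qed.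

(** The slice is the zero set of [theta] in a compact neighbourhood [B] of [pe]. The estimate above
    gives uniqueness directly, and existence through [solve_near_identity]. *)
Lemma local_slice (pe : P) (theta : 'rV[R]_d -> 'rV[R]_n)
    (T : {linear 'rV[R]_d -> 'rV[R]_n}) (U : set P) :
  strict_diff theta (chart pe pe) T ->
  (forall xi, T (inf_action act xi pe) = xi) ->
  theta (chart pe pe) = 0 ->
  (\forall x \near chart pe pe, {for x, continuous theta}) ->
  nbhs pe U ->
  exists S : set P, [/\ compact S, S pe,
    (forall p, S p -> U p /\ theta (chart pe p) = 0),
    (forall p g, S p -> S (act g p) -> g = 1%g) &
    forall W : set G, nbhs (1%g : G) W ->
      \forall p \near pe, exists2 g, W g & S (act g p)].
Proof.
move=> theta_s T_inf theta0 thetac Un; have [act1 _ [actc _]] := hact.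
have [rho rho0 est] := slice_estimate theta_s T_inf.
have theta_chart : \forall p \near pe, {for chart pe p, continuous theta}.
  exact: (@chart_self_continuous _ _ _ pe _ thetac).
have [B0 B0n B01] := near_same_point hact hproper hfree pe (@log_ball_nbhs R n G _ rho0).
have [B [Bc Bn BP]] := compact_nbhs (filterI Un (filterI est (filterI theta_chart
  (filterI B0n (chart_dom_nbhs (chart_dom_self pe)))))).
pose S := B `&` [set p | theta (chart pe p) = 0].
have Bcl : closed B by apply: compact_closed => //; exact: manifold_hausdorff.
have tc p : B p -> {for p, continuous (theta \o chart pe)}.
  move=> /BP[_ [_ [tp [_ pd]]]]; apply: (@continuous_comp _ _ _ (chart pe) theta) => //.
  exact: chart_continuous.
have Scl : closed S.
  move=> p pS; have Bp : B p by apply: Bcl; apply: closure_subset pS => q [].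
  split=> //; apply: contrapT => /eqP tp0.
  have : \forall q \near p, (theta \o chart pe) q != 0.
    by apply: cvgr_neq0 tp0; exact: tc.
  by move=> /pS[q [[_ /= tq]]] /=; rewrite tq eqxx.
have o0 : `|chart (1%g : G) 1%g - chart (1%g : G) 1%g| <= rho.
  by rewrite subrr normr0 ltW.
exists S; split.
- by apply: subclosed_compact Bc _ => // p [].
- by split=> //; exact: nbhs_singleton Bn.
- by move=> p [/BP[Up _] ?].
- move=> p g [Bp tp] [Bgp tgp].
  have [_ [estp [_ [B0p _]]]] := BP _ Bp; have [_ [_ [_ [B0gp _]]]] := BP _ Bgp.
  (* Since [p] and [g p] both lie in [B0], the element [g] is close enough to 1 for the estimate. As
     [theta] vanishes at both points, [|log1 g|] is at most half of itself. *)
  have [gd gr] := B01 _ _ B0p B0gp.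
  have := estp _ _ o0 gr; rewrite chartK_self chartK// act1 tp tgp.
  rewrite subrr sub0r normrN -/(log1 g) => lg.
  have /eqP : `|log1 g| = 0 by have := normr_ge0 (log1 g); lra.
  rewrite normr_eq0 subr_eq0 => /eqP /(congr1 (chart_inv (1%g : G))).
  by rewrite chartK// chartK_self.
move=> W Wn.
have : \forall z \near ((1%g : G), pe), B (act z.1 z.2).
  by have := actc (1%g, pe) B; rewrite /= act1; exact.
move=> [[W1 V1] /= [W1n V1n] WV1].
(* The radius [eta] keeps the solution in [W], as required, and in [W1], so that the moved point
   remains in [B]. *)
have [eta [eta0 etaP _ _]] := compact_chart_ball (filterI Wn W1n).
pose F (y : 'rV[R]_n) (p : P) := theta (chart pe (act (chart_inv (1%g : G) y) p)).
have F0 : F (chart (1%g : G) 1%g) p @[p --> pe] --> (0 : 'rV[R]_n).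
  rewrite -theta0; have := tc _ (nbhs_singleton Bn); apply: cvg_trans.
  by apply: near_eq_cvg; apply: nearW => p; rewrite /F /= chartK_self act1.
have := solve_near_identity rho0 est F0 eta0.
apply: filterS2 V1n => p V1p [y yeta Fy].
have [_ [Wy W1y]] := etaP _ yeta.
exists (chart_inv (1%g : G) y) => //; split; last exact: Fy.
exact: (WV1 (_, _)).
Qed.

End LocalSlice.

Section AffinePerturbation.
Context {R : realType} {V W X : normedModType R}.

Lemma strict_diff_affine (f : V -> W) (x : V) (L : V -> W) (m : W)
    (B : {linear W -> X}) (C : {linear V -> X}) :
  continuous B -> strict_diff f x L ->
  strict_diff (fun y => B (f y - m) + C (y - x)) x (fun v => B (L v) + C v).
Proof.
move=> Bc sf e e0; have [k k0 Bk] := linear_lipschitz Bc.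
have ek : 0 < e / k by rewrite divr_gt0.
apply: filterS (sf _ ek) => -[y z] /= yz.
have -> : B (f z - m) + C (z - x) - (B (f y - m) + C (y - x)) -
    (B (L (z - y)) + C (z - y)) = B (f z - f y - L (z - y)).
  have Cd : C (z - y) = C (z - x) - C (y - x) by rewrite -linearB opprB subrKA.
  have Bd : B (f z - f y) = B (f z - m) - B (f y - m).
    by rewrite -linearB opprB subrKA.
  rewrite [B (_ - L _)]linearB Bd Cd (opprD (B _) (C (y - x))) addrACA.
  move: (B (f z - m) - _) (C (z - x) - _) (B (L _)) => b c l.
  by rewrite opprD addrACA subrr addr0.
apply: le_trans (Bk _) _; apply: le_trans (ler_wpM2l (ltW k0) yz) _.
by rewrite mulrA mulrCA divff ?gt_eqF// mulr1.
Qed.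

End AffinePerturbation.

(** * A slice with momentum in the affine space through [J pe] along the annihilator *)

Section MomentumSlice.
Context {R : realType} {n d : nat} {G : lieGroupType R n} {P : manifoldType R d}.
Variables (omega : P -> 'rV[R]_d -> 'rV[R]_d -> R) (homega : symplectic_form omega).
Variables (act : G -> P -> P) (hact : smooth_action act).
Hypotheses (hfree : free_action act) (hproper : proper_action act).
Variables (J : P -> 'cV[R]_n) (hJ : momentum_map omega act J).
Hypothesis hJequiv : equivariant_momentum act J.

Lemma mulmx_tr_eq0 m (w : 'rV[R]_m) : w *m w^T = 0 -> w = 0.
Proof.
move=> /matrixP/(_ 0 0); rewrite !mxE => /eqP.
rewrite psumr_eq0 => [/allP w0|i _]; last by rewrite mxE -expr2 sqr_ge0.
apply/rowP => i; have := w0 i (mem_index_enum _).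
by rewrite !mxE mulf_eq0 orbb => /eqP.
Qed.

Variables (pe : P) (N : {vspace 'rV[R]_n}).
Hypothesis hN : is_complement N (Lie_algebra_of (@coAd_isotropy R n G (J pe))).

(* The slice is cut out by [theta = ((J - J pe)^T Pi^T Pi + (x - x0) D^-1 (1 - Pi)) L^-1],
   where [D^-1] is a right inverse of [D]. As [Pi] is idempotent, its image and that of
   [1 - Pi] are complementary, so both terms vanish separately where [theta = 0]; and [L]
   makes the derivative of [theta] along the orbit the identity. *)
Let D : 'M[R]_(n, d) := lin1_mx (tangent_map (act^~ pe) (1%g : G)).
Let DJ : 'M[R]_(d, n) := lin1_mx (trmx \o differential J pe).
Let Pi : 'M[R]_n := lin1_mx (projv N).
Let L : 'M[R]_n := D *m DJ *m Pi^T *m Pi + (1%:M - Pi).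

Let DE xi : xi *m D = inf_action act xi pe.
Proof. by rewrite mul_rV_lin1. Qed.

Let DJE v : v *m DJ = (differential J pe v)^T.
Proof. by rewrite mul_rV_lin1. Qed.

Let PiE xi : xi *m Pi = projv N xi.
Proof. by rewrite mul_rV_lin1. Qed.

Let Pi_id : Pi *m Pi = Pi.
Proof.
by apply/row_matrixP => i; rewrite row_mul !PiE rowE PiE projv_id// memv_proj.
Qed.

Let Pi_sub0 : (1%:M - Pi) *m Pi = 0.
Proof. by rewrite mulmxBl mul1mx Pi_id subrr. Qed.

(** The product of [v *m Pi^T] with its own transpose is [v *m Pi^T *m Pi *m v^T], and a real row
    with zero sum of squares is zero. *)
Let mul_trPi_Pi_eq0 (v : 'rV[R]_n) : v *m Pi^T *m Pi = 0 -> v *m Pi^T = 0.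
Proof.
by move=> v0; apply: mulmx_tr_eq0; rewrite trmx_mul trmxK mulmxA v0 mul0mx.
Qed.

Let annihilatorP (nu : 'cV[R]_n) : nu^T *m Pi^T = 0 -> annihilator N nu.
Proof.
move=> nu0 xi xiN; rewrite /pairing -(projv_id xiN) -PiE -mulmxA.
by rewrite -[Pi *m nu]trmxK trmx_mul nu0 trmx0 mulmx0 mxE.
Qed.

(** If [x L = 0], multiplication by [Pi] shows that both terms of [x L] vanish. The second puts [x]
    in [N]; the first says that [dJ (x pe)] annihilates [N]. It annihilates the isotropy algebra by
    skewness, so [x] lies in that algebra too, and [x = 0]. *)
Let L_unit : L \in unitmx.
Proof.
have [hJs _] := hJ.
rewrite -row_free_unit; apply: inj_row_free => x xL0.
have v0 : x *m D *m DJ *m Pi^T *m Pi = 0.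
  have : x *m L *m Pi = 0 by rewrite xL0 mul0mx.
  rewrite /L mulmxDr mulmxDl -[_ *m (1%:M - Pi) *m Pi]mulmxA Pi_sub0 mulmx0 addr0.
  by rewrite !mulmxA -(mulmxA _ Pi Pi) Pi_id.
have xN : x \in N.
  move: xL0; rewrite /L mulmxDr !mulmxA v0 add0r mulmxBr mulmx1.
  by move=> /eqP; rewrite subr_eq0 PiE => /eqP ->; exact: memv_proj.
have [NK split_N] := hN.
apply: NK => //; apply/(Lie_algebra_isotropy hact hJs hJequiv).
apply: pairing_eq0 => eta; have [a [b [aK bN ->]]] := split_N eta.
move/(Lie_algebra_isotropy hact hJs hJequiv) : aK => a0.
have pairingD (mu : 'cV[R]_n) : pairing mu (a + b) = pairing mu a + pairing mu b.
  by rewrite /pairing mulmxDl mxE.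
rewrite pairingD (inf_action_pairing_skew homega hJ) a0.
have -> : pairing 0 x = 0 by rewrite /pairing mulmx0 mxE.
rewrite oppr0 add0r; apply: (annihilatorP _ bN).
by rewrite -DJE -DE; exact: mul_trPi_Pi_eq0.
Qed.

Lemma momentum_slice (U : set P) : nbhs pe U ->
  exists S : set P, [/\ compact S, S pe,
    (forall p, S p -> U p /\ annihilator N (J p - J pe)),
    (forall p g, S p -> S (act g p) -> g = 1%g) &
    forall W : set G, nbhs (1%g : G) W ->
      \forall p \near pe, exists2 g, W g & S (act g p)].
Proof.
move=> Un; have [hJs _] := hJ.
(* Freeness makes the rows of [D] independent, which provides a right inverse. *)
have [Di DDi] : exists Di, D *m Di = 1%:M.
  exists (pinvmx D); apply: mulmxVp; apply: inj_row_free => xi; rewrite DE.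
  exact: inf_action_inj.
pose B : {linear 'cV[R]_n -> 'rV[R]_n} := mulmxr (Pi^T *m Pi *m invmx L) \o trmx.
pose C : {linear 'rV[R]_d -> 'rV[R]_n} := mulmxr (Di *m (1%:M - Pi) *m invmx L).
have Bc : continuous B by apply: finite_basis_linear_continuous; exact: finite_basis_mx.
have Cc : continuous C by apply: finite_basis_linear_continuous; exact: finite_basis_mx.
pose x0 := chart pe pe.
pose Jc := J \o chart_inv pe.
have [Jd Js] := smooth_on_strict_diff (@finite_basis_mx R 1 d) (hJs pe)
  (chart_im_nbhs (chart_im_self pe)).
pose theta y := B (Jc y - J pe) + C (y - x0).
pose T : {linear 'rV[R]_d -> 'rV[R]_n} := (B \o differential J pe) \+ C.
have theta_s : strict_diff theta x0 T by exact: strict_diff_affine.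
have T_inf xi : T (inf_action act xi pe) = xi.
  rewrite /T/= -DJE -DE !mulmxA -(mulmxA xi D Di) DDi mulmx1.
  rewrite -mulmxDl; apply: (canLR (mulmxK L_unit)).
  by rewrite /L [RHS]mulmxDr !mulmxA.
have theta0 : theta x0 = 0.
  have Jx0 : Jc x0 = J pe by rewrite /Jc/= chartK_self.
  by rewrite /theta Jx0 !subrr (linear0 B) (linear0 C) addr0.
have thetac : \forall x \near x0, {for x, continuous theta}.
  apply: filterS Jd => x /differentiable_continuous Jx.
  have c1 : {for x, continuous (B \o (fun y => Jc y - J pe))}.
    by apply: continuous_comp; [apply: continuousB => //; exact: cst_continuous|exact: Bc].
  have c2 : {for x, continuous (C \o (fun y => y - x0))}.
    by apply: continuous_comp; [apply: continuousB => //; exact: cst_continuous|exact: Cc].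
  exact: cvgD c1 c2.
have [S [Sc Spe SU Suniq Sex]] := local_slice hact hproper hfree theta_s T_inf theta0
  thetac (filterI Un (chart_dom_nbhs (chart_dom_self pe))).
exists S; split=> // p /SU[[Up pd] theta_p]; split=> //.
apply: annihilatorP; apply: mul_trPi_Pi_eq0.
move: theta_p; rewrite /theta /Jc /B /C/= chartK// !mulmxA -mulmxDl.
(* Multiplying [theta = 0] by [L *m Pi] cancels [invmx L] and kills the term in [1%:M - Pi], leaving
   [(J p - J pe)^T *m Pi^T *m Pi = 0]. *)
move=> /(congr1 (mulmx^~ (L *m Pi))); rewrite /= mulmxA mulmxKV// mul0mx.
by rewrite mulmxDl -!mulmxA Pi_id Pi_sub0 !mulmx0 addr0.
Qed.

End MomentumSlice.

(** * From a momentum slice to stability *)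

Theorem theorem5p2 (R : realType) (n d : nat)
    (G : lieGroupType R n) (P : manifoldType R d)
    (omega : P -> 'rV[R]_d -> 'rV[R]_d -> R) (homega : symplectic_form omega)
    (act : G -> P -> P) (hact : smooth_action act)
    (hfree : free_action act) (hproper : proper_action act)
    (hsymp : symplectic_action omega act)
    (J : P -> 'cV[R]_n) (hJ : momentum_map omega act J)
    (hJequiv : equivariant_momentum act J)
    (H : P -> R) (hH : invariant_hamiltonian act H)
    (pe : P) (hpe : relative_equilibrium omega act H pe)
    (mue : 'cV[R]_n) (hmue : mue = J pe)
    (N : {vspace 'rV[R]_n})
    (hN : is_complement N (Lie_algebra_of (@coAd_isotropy R n G mue)))
    (hstable : G_stable omega act H pe)
    (V : set 'cV[R]_n) (hV : nbhs0_in (annihilator N) V)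
    (W : set G) (hW : nbhs (1%g : G) W) :
  A_stable omega act (A_VW mue V W) H pe.
Proof.
move=> U [Uo Upe]; rewrite {}hmue in hN *.
have [act1 actM [actc _]] := hact; have [hJs _] := hJ.
have [VN [O O0 OV]] := hV.
have : \forall z \near ((1%g : G), pe), U (act z.1 z.2).
  have := actc (1%g, pe) U; rewrite /= act1; apply.
  exact: open_nbhs_nbhs.
move=> [[W0 U0] /= [W0n U0n] WU0].
have OJ : \forall p \near pe, O (J p - J pe).
  have : J p - J pe @[p --> pe] --> (0 : 'cV[R]_n).
    rewrite -(subrr (J pe)); apply: cvgB; last exact: cvg_cst.
    exact: smooth_fun_continuous.
  exact.
have [S [Sc Spe SU Suniq Sex]] :=
  momentum_slice homega hact hfree hproper hJ hJequiv hN (filterI U0n OJ).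
have SV p : S p -> V (J p - J pe) by move=> /SU[[_ Op] Np]; exact: OV.
have Suniq2 p g h : S (act g p) -> S (act h p) -> g = h.
  move=> Sg Sh; apply/eqP; rewrite -[_ == _](can_eq (mulgK h^-1%g)) mulgV; apply/eqP.
  by apply: (Suniq (act h p)); rewrite -?actM ?mulgVK.
(* The saturation of the slice is the invariant neighbourhood to which [G]-stability is applied. *)
pose D := [set q | exists g, S (act g q)].
have Dinv : invariant_set act D.
  by move=> g p [h Sh]; exists (h * g^-1)%g; rewrite -actM mulgVK.
have Dn : nbhs pe D by apply: filterS (Sex setT filterT) => p [g _ Sg]; exists g.
have [V0 V0n V0D] := hstable D Dn Dinv.
(* The conjugating element will be [g0^-1]: it has to lie in [W] for the definition of [A_VW], and
   in [W0] to carry slice points into [U]. *)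
pose W' := [set g : G | (W `&` W0) (g^-1)%g].
have W'n : nbhs (1%g : G) W'.
  apply: (@invg_cvg R n G _ (nbhs (1%g : G)) id 1%g) => //.
  by rewrite invg1; exact: filterI.
exists (interior (V0 `&` [set p | exists2 g, W' g & S (act g p)])).
  by split; [exact: open_interior|apply: filterI => //; exact: Sex].
move=> p /interior_subset[V0p [g0 [Wg0 W0g0] Sg0]].
have [c cflow cD] := V0D p V0p; have [c0 cv] := cflow.
exists c => // t.
have [tau tauS] := choice cD.
have tau0 : tau 0 = g0 by apply: (@Suniq2 p) => //; rewrite -c0.
have tauc : continuous tau.
  move=> s O1; rewrite nbhsE => -[O2 [O2o O2s] O21].
  (* Only [tau s] moves [c s] into the compact slice, so the transporters of nearby points lie in
     any given open set around [tau s]. *)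
  have : \forall q \near c s, forall g, S (act g q) -> O2 g.
    by apply: transporter_near => // g Sg; rewrite (Suniq2 (c s) g (tau s)).
  have [cc _] := cv s; move=> /cc; apply: (@filterS _ _ (nbhs_filter s)) => r /=.
  by move=> /(_ _ (tauS r)); exact: O21.
pose z s := (g0 * (tau s)^-1)%g.
have zc : continuous z.
  by move=> s; apply: mulg_cvg; [exact: cvg_cst|apply: invg_cvg; exact: tauc].
have z0 : z 0 = 1%g by rewrite /z tau0 mulgV.
pose u s := act (tau s) (c s).
pose nu := J (act g0 p) - J pe.
have coAd_z s : coAd (z s) (J pe + nu) = J (u s).
  rewrite /nu addrC subrK.
  (* Conservation of [J] replaces [p] by [c s]; equivariance then moves [z s] onto the point, since
     [(z s)^-1 * g0 = tau s]. *)
  have -> : J (act g0 p) = J (act g0 (c s)).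
    by rewrite !hJequiv (noether hact hJs homega hJ hH cflow).
  rewrite -[z s]invgK -hJequiv -actM /z invgM invgK mulgVK //.
exists (g0^-1 * z t * g0)%g.
  exists g0^-1%g => //; exists (z t); last by rewrite invgK.
  exists nu; first exact: SV.
  (* The whole path [z] is a connected set through 1 and [z t], and its coadjoint images of
     [J pe + nu] are momenta of slice points. *)
  exists (range z); last by exists t.
  split; first by exists 0.
    move=> _ [s _ <-]; exists (J (u s) - J pe); first exact: SV (tauS s).
    by rewrite coAd_z [RHS]addrC subrK.
  apply: connected_continuous_connected; last exact: continuous_subspaceT.
  by apply/connected_intervalP.
exists (act g0^-1%g (u t)).
  have [[U0u _] _] := SU _ (tauS t).
  exact: (WU0 (_, _)).
by rewrite -!actM mulgK /z -!mulgA mulKg mulVg act1.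
Qed.
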